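(* Let $k$ be an infinite field with $\operatorname{char}(k)\neq 2$ and let $\mathcal{Q}^{n-1}\subset\mathbb{P}^{1}\times\mathbb{P}^{n}$ be a divisor of bidegree $(3,2)$ over $k$ that has a $k$-rational point and is otherwise general. If $n\geq 4$ then $\mathcal{Q}^{n-1}$ is unirational over $k$.
   Context: An $n$-dimensional variety $X$ over $k$ is unirational if there is a dominant rational map $\mathbb{P}^n_k\dashrightarrow X$ over $k$. A divisor of bidegree $(3,2)$ in $\mathbb{P}^1_{(x_0,x_1)}\times\mathbb{P}^n_{(y_0,\dots,y_n)}$ is the zero locus of a polynomial that is homogeneous of degree $3$ in $x_0,x_1$ and of degree $2$ in $y_0,\dots,y_n$; it is regarded as a quadric bundle over $\mathbb{P}^1$ via the first projection $\pi:\mathcal{Q}^{n-1}\to\mathbb{P}^1$. ''Has a point and is otherwise general'' means general among the divisors having a $k$-rational point: for a $k$-rational point $p\in\mathbb{P}^1\times\mathbb{P}^n$, the defining polynomial is a general element (i.e. lies in a suitable nonempty Zariski-open subset) of the linear space of bihomogeneous polynomials of bidegree $(3,2)$ over $k$ vanishing at $p$. *)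

(* Defs.v *)
From mathcomp Require Export all_boot all_order all_algebra.
From mathcomp Require Export mpoly.

Set Implicit Arguments.
Unset Strict Implicit.
Unset Printing Implicit Defensive.

Import GRing.Theory.
Local Open Scope ring_scope.

Definition infinite_field (k : fieldType) : Prop :=
  forall s : seq k, exists c : k, c \notin s.

(* In [{mpoly k[2 + n.+1]}] the first two variables are x_0, x_1 and the last
   n + 1 are y_0, ..., y_n.  The zero polynomial has every bidegree. *)
Definition bihomogeneous (k : fieldType) (n d e : nat)
    (f : {mpoly k[2 + n.+1]}) : Prop :=
  forall m, m \in msupp f ->
    (\sum_(i < 2) m (lshift n.+1 i))%N = d /\
    (\sum_(j < n.+1) m (rshift 2 j))%N = e.

(* Points of P^1 x P^n are given by nonzero vectors of homogeneous coordinates,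
   with values in an arbitrary field extension iota : k -> K. *)
Definition vanishes_at (k K : fieldType) (iota : {rmorphism k -> K}) (n : nat)
    (f : {mpoly k[2 + n.+1]}) (x : 'rV[K]_2) (y : 'rV[K]_n.+1) : Prop :=
  mmap iota (row_mx x y 0) f = 0.

(* A divisor of P^1 x P^n is an integral scheme iff its equation is an
   irreducible element of the (factorial) bihomogeneous coordinate ring. *)
Definition irreducible_mpoly (k : fieldType) (N : nat) (f : {mpoly k[N]}) :
    Prop :=
  [/\ f != 0, f \isn't a GRing.unit &
      forall g h : {mpoly k[N]}, f = g * h ->
        g \is a GRing.unit \/ h \is a GRing.unit].

(* Since k[t_0, ..., t_d] is factorial, every rational map P^d --> P^1 x P^n is
   given by two nonzero vectors of forms of the same degree. *)
Record rational_map (k : fieldType) (d n : nat) := RationalMap {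
  rmap_x : 'rV[{mpoly k[d.+1]}]_2;
  rmap_y : 'rV[{mpoly k[d.+1]}]_n.+1;
  rmap_x_neq0 : rmap_x != 0;
  rmap_y_neq0 : rmap_y != 0;
  rmap_x_homog : exists e : nat, forall i, rmap_x 0 i \is e.-homog;
  rmap_y_homog : exists e : nat, forall j, rmap_y 0 j \is e.-homog
}.

Definition eval_row (k K : fieldType) (iota : {rmorphism k -> K}) (d m : nat)
    (a : 'rV[{mpoly k[d.+1]}]_m) (t : 'rV[K]_d.+1) : 'rV[K]_m :=
  map_mx (mmap iota (t 0)) a.

(* All the points of P^d, over all extensions of k, at which the given
   coordinates of phi define a point are sent into the zero locus of g. *)
Definition image_in (k : fieldType) (d n : nat) (phi : rational_map k d n)
    (g : {mpoly k[2 + n.+1]}) : Prop :=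
  forall (K : fieldType) (iota : {rmorphism k -> K}) (t : 'rV[K]_d.+1),
    t != 0 ->
    eval_row iota (rmap_x phi) t != 0 -> eval_row iota (rmap_y phi) t != 0 ->
    vanishes_at iota g (eval_row iota (rmap_x phi) t)
                       (eval_row iota (rmap_y phi) t).

Definition zeros_subset (k : fieldType) (n : nat)
    (f g : {mpoly k[2 + n.+1]}) : Prop :=
  forall (K : fieldType) (iota : {rmorphism k -> K})
    (x : 'rV[K]_2) (y : 'rV[K]_n.+1),
    x != 0 -> y != 0 -> vanishes_at iota f x y -> vanishes_at iota g x y.

(* phi is a dominant rational map to the divisor f = 0: its image lies in this
   divisor and in no smaller Zariski closed subset. *)
Definition dominant_onto (k : fieldType) (d n : nat) (phi : rational_map k d n)
    (f : {mpoly k[2 + n.+1]}) : Prop :=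
  image_in phi f /\
  forall (a b : nat) (g : {mpoly k[2 + n.+1]}),
    bihomogeneous a b g -> image_in phi g -> zeros_subset f g.

(* The divisor f = 0 of P^1 x P^n has dimension n, so that the source of the
   parametrization is P^n. *)
Definition unirational_divisor (k : fieldType) (n : nat)
    (f : {mpoly k[2 + n.+1]}) : Prop :=
  irreducible_mpoly f /\
  exists phi : rational_map k n n, dominant_onto phi f.

Definition forms_through (k : fieldType) (n d e : nat)
    (p : 'rV[k]_2) (q : 'rV[k]_n.+1) (f : {mpoly k[2 + n.+1]}) : Prop :=
  bihomogeneous d e f /\ vanishes_at idfun f p q.

(* Polynomial functions on a finite-dimensional space of polynomials are the
   polynomial expressions F in finitely many of the coefficients. *)
Definition coef_eval (k : fieldType) (N r : nat) (ms : r.-tuple 'X_{1..N})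
    (F : {mpoly k[r]}) (f : {mpoly k[N]}) : k :=
  F.@[fun i => f@_(tnth ms i)].

(* U is the trace on V of the complement of the common zeros of the polynomial
   functions selected by S. *)
Definition zariski_open_in (k : fieldType) (N : nat)
    (V U : {mpoly k[N]} -> Prop) : Prop :=
  exists S : forall r : nat, r.-tuple 'X_{1..N} -> {mpoly k[r]} -> Prop,
    forall f, U f <->
      V f /\ exists (r : nat) (ms : r.-tuple 'X_{1..N}) (F : {mpoly k[r]}),
               S r ms F /\ coef_eval ms F f != 0.

Definition for_general (k : fieldType) (N : nat)
    (V P : {mpoly k[N]} -> Prop) : Prop :=
  exists U : {mpoly k[N]} -> Prop,
    [/\ zariski_open_in V U, exists f, U f & forall f, U f -> P f].

(* Main.v *)
Require Import Defs.
From mathcomp Require Import ring zify.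

Set Implicit Arguments.
Unset Strict Implicit.
Unset Printing Implicit Defensive.

Import GRing.Theory.
Local Open Scope ring_scope.

(** Let [X] be the divisor [f = 0]. Choose coordinates [(a : c)] on [P^1] in which [p = (1 :
0)], and write [f = a^3 N0 + a^2 c N1 + a c^2 N2 + c^3 N3] with quadratic forms [N_i] in [y], so
that [N0(q) = 0]. The quadric bundle [X -> P^1] becomes rational as soon as it has a section, so
it is enough to find a rational curve in [X] that dominates [P^1]: after base change to this
curve the bundle has a section.

The curve comes from the point [q]. The binary cubic [f(., q)] is [c u] for a binary quadratic
form [u]. Consider the points [y] of [P^n] such that [u] divides the binary cubic [f(., y)]. The
remainder of the division by [u] has two coefficients, so these points form an intersection of
two quadrics, [R1 = R2 = 0], which contains [q]; and each of them gives a point of [X], with [x]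
the root of the linear form [f(., y) / u]. As [n >= 4], we may cut with a general 4-dimensional
linear space through [q] and suppose that this intersection is a surface. It then contains
rational curves defined over [k]: choose a tangent direction [v] at [q]. The hyperplane sections
that are singular at [q] are nodal curves, and one of them has [v] as the tangent of a branch at
its node, which makes it a rational curve over [k]. This is the parametrized quartic
[curve_point], with [x = (curve_a : curve_b)].

A point [t] of [P^n] determines a parameter [s = e2(t) / e0(t)] of the curve, hence a quadric of
the bundle with a point [Y] on it; send [t] to the second point of intersection of this quadric
with the line joining [Y] and [t]. This is a rational map [P^n --> X] given by forms of degree 8
and 30.

To see that it is dominant, let [g] vanish on its image. Restricted to the fibre over [x(s)] and
to a line [w + T q], [g] is divisible by [f]: it vanishes at all the second intersection points,
and these are dense in the quadric ([line_dvd]). The pseudo-remainder of [g(x, y + T q)] by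
[f(x, y + T q)] is therefore zero at all [x = x(s)], hence zero, because [x(s)] takes infinitely
many values ([generic_divisibility]). So [f] divides [c g] with [c] depending on [x] only, and
[c] can be cancelled along an arc through a given zero of [f], as [f] vanishes on no whole fibre
([zeros_subset_of_image]).

All this works under finitely many conditions: [N0, ..., N3] are linearly independent, [x(s)] is
not constant, and some expressions attached to one fibre do not vanish. Their product
[good_datum] is a polynomial in the coefficients of [f], which is nonzero at an explicit sparse
equation ([example_is_good]). The same conditions give the irreducibility of [f]: a factor of
degree 0 in [y] would divide all binary cubic forms, and a factor of degree 1 in [y] would make
a fibre a union of two hyperplanes ([irreducible_of_good]). *)

(** * Quadratic forms *)

(** Sealed expressions unfold only through the lemmas named [_def]: expanded, the coordinates of
the parametrization below are forms of degree up to 30. *)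
Fact seal_key : unit. Proof. by []. Qed.
Local Notation sealed := (locked_with seal_key).

Section QuadraticForms.
Variables (A : comNzRingType) (m : nat).
Implicit Types (M : 'M[A]_m) (y z w : 'rV[A]_m) (c : A).

Definition qf M y : A := sealed ((y *m M *m y^T) 0 0).

Definition bf M y z : A := sealed ((y *m M *m z^T) 0 0 + (z *m M *m y^T) 0 0).

Lemma qf_def M y : qf M y = (y *m M *m y^T) 0 0.
Proof. exact: locked_withE. Qed.

Lemma bf_def M y z : bf M y z = (y *m M *m z^T) 0 0 + (z *m M *m y^T) 0 0.
Proof. exact: locked_withE. Qed.

Lemma bfC M y z : bf M y z = bf M z y.
Proof. by rewrite !bf_def addrC. Qed.

Lemma bfDl M y z w : bf M (y + z) w = bf M y w + bf M z w.
Proof. by rewrite !bf_def [(_ + _)^T]linearD /= !mulmxDl !mulmxDr !mxE; ring. Qed.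

Lemma bfZl M c y z : bf M (c *: y) z = c * bf M y z.
Proof. by rewrite !bf_def [(_ *: _)^T]linearZ /= -!scalemxAl -!scalemxAr !mxE; ring. Qed.

Lemma bfDr M y z w : bf M w (y + z) = bf M w y + bf M w z.
Proof. by rewrite bfC bfDl !(bfC M w). Qed.

Lemma bfZr M c y z : bf M y (c *: z) = c * bf M y z.
Proof. by rewrite bfC bfZl (bfC M y). Qed.

Lemma qfD M y z : qf M (y + z) = qf M y + bf M y z + qf M z.
Proof. by rewrite !qf_def bf_def [(_ + _)^T]linearD /= !mulmxDl !mulmxDr !mxE; ring. Qed.

Lemma qfZ M c y : qf M (c *: y) = c ^+ 2 * qf M y.
Proof. by rewrite !qf_def [(_ *: _)^T]linearZ /= -scalemxAr -!scalemxAl !mxE; ring. Qed.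

Lemma bfyy M y : bf M y y = qf M y + qf M y.
Proof. by rewrite bf_def qf_def. Qed.

Lemma qfDM M N y : qf (M + N) y = qf M y + qf N y.
Proof. by rewrite !qf_def mulmxDr mulmxDl mxE. Qed.

Lemma qfZM M c y : qf (c *: M) y = c * qf M y.
Proof. by rewrite !qf_def -scalemxAr -scalemxAl mxE. Qed.

Lemma bfDM M N y z : bf (M + N) y z = bf M y z + bf N y z.
Proof. by rewrite !bf_def !mulmxDr !mulmxDl !mxE; ring. Qed.

Lemma bfZM M c y z : bf (c *: M) y z = c * bf M y z.
Proof. by rewrite !bf_def -!scalemxAr -!scalemxAl !mxE; ring. Qed.

Definition bfE := (bfDl, bfDr, bfZl, bfZr).
Definition qfE := (qfD, qfZ, bfDl, bfDr, bfZl, bfZr).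

End QuadraticForms.

Section TwoQuadrics.
Variables (A : comNzRingType) (m : nat) (R1 R2 : 'M[A]_m) (q v w : 'rV[A]_m).
Variable d : A.

Let h := qf R1 v * bf R2 v w - qf R2 v * bf R1 v w.
Let g := qf R1 v * qf R2 w - qf R2 v * qf R1 w.
Let kappa := g ^+ 2 + h * (qf R1 w * bf R2 v w - qf R2 w * bf R1 v w).

(** With [q] on two quadrics, [v] tangent to both at [q] and [w] in a hyperplane through the
tangent space such that [v] is a branch direction of the section, the line through [v] and [w]
meets the conic [R1(v) R2 = R2(v) R1] again at [z = - g v + h w]. As [R1(z) : R2(z) = R1(v) :
R2(v)], the two quadrics meet the line through [q] and [z] at the same second point. *)
Definition quartic_point : 'rV[A]_m :=
  (- kappa) *: q + (h * d) *: ((- g) *: v + h *: w).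

Lemma quartic_point_on_quadrics :
  qf R1 q = 0 -> qf R2 q = 0 -> bf R1 q v = 0 -> bf R2 q v = 0 ->
  bf R1 q w = d * qf R1 v -> bf R2 q w = d * qf R2 v ->
  qf R1 quartic_point = 0 /\ qf R2 quartic_point = 0.
Proof.
move=> q1 q2 v1 v2 w1 w2.
rewrite /quartic_point !qfE q1 q2 v1 v2 w1 w2 /kappa /g /h.
by split; ring.
Qed.

End TwoQuadrics.

(** * The rational map *)

(** The pencil of quadrics, five vectors [b0, ..., b4] with [b0] the given point of the quadric
[N0], and two linear forms [e0] and [e2]. It is defined over any ring, so that the same formulas
serve for the generic equation, for the generic point and for specializations. *)
Record datum (A : comNzRingType) (m : nat) := Datum {
  N0 : 'M[A]_m; N1 : 'M[A]_m; N2 : 'M[A]_m; N3 : 'M[A]_m;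
  b0 : 'rV[A]_m; b1 : 'rV[A]_m; b2 : 'rV[A]_m; b3 : 'rV[A]_m; b4 : 'rV[A]_m;
  e0 : 'cV[A]_m; e2 : 'cV[A]_m }.

Definition map_datum (A B : comNzRingType) (s : A -> B) m (D : datum A m) :=
  Datum (map_mx s (N0 D)) (map_mx s (N1 D)) (map_mx s (N2 D)) (map_mx s (N3 D))
        (map_mx s (b0 D)) (map_mx s (b1 D)) (map_mx s (b2 D)) (map_mx s (b3 D))
        (map_mx s (b4 D)) (map_mx s (e0 D)) (map_mx s (e2 D)).

Section Construction.
Variables (A : comNzRingType) (m : nat) (D : datum A m).
Implicit Types (y z w : 'rV[A]_m) (t a b c : A).

Definition linv (e : 'cV[A]_m) y : A := (y *m e) 0 0.

Definition cubic_pencil a b : 'M[A]_m :=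
  a ^+ 3 *: N0 D + (a ^+ 2 * b) *: N1 D + (a * b ^+ 2) *: N2 D + b ^+ 3 *: N3 D.

Local Notation al1 := (qf (N1 D) (b0 D)).
Local Notation al2 := (qf (N2 D) (b0 D)).
Local Notation al3 := (qf (N3 D) (b0 D)).

(** The remainder of [al1^2 f(., y)] by [f(., b0) / c = al1 a^2 + al2 a c + al3 c^2] is [a c^2
remainder1 + c^3 remainder2]. *)
Definition remainder1 : 'M[A]_m :=
  al1 ^+ 2 *: N2 D + (- (al1 * al3)) *: N0 D + (- (al1 * al2)) *: N1 D
    + al2 ^+ 2 *: N0 D.
Definition remainder2 : 'M[A]_m :=
  al1 ^+ 2 *: N3 D + (- (al1 * al3)) *: N1 D + (al2 * al3) *: N0 D.

Local Notation l1 := (bf remainder1 (b0 D)).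
Local Notation l2 := (bf remainder2 (b0 D)).

(** Cramer's rule for the two tangent hyperplanes at [b0], in the basis given by [b1] and [b2].
*)
Definition tangent_det : A := sealed (l1 (b1 D) * l2 (b2 D) - l1 (b2 D) * l2 (b1 D)).

Lemma tangent_det_def : tangent_det = l1 (b1 D) * l2 (b2 D) - l1 (b2 D) * l2 (b1 D).
Proof. exact: locked_withE. Qed.

(** Projection to the tangent space at [b0] of the intersection of the two remainder quadrics,
along [b1] and [b2], multiplied by [tangent_det] to clear the denominator. *)
Definition tangent_proj y : 'rV[A]_m :=
  sealed (tangent_det *: y + (l2 y * l1 (b2 D) - l1 y * l2 (b2 D)) *: b1 D
            + (l2 (b1 D) * l1 y - l1 (b1 D) * l2 y) *: b2 D).

Lemma tangent_proj_def y : tangent_proj y =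
  tangent_det *: y + (l2 y * l1 (b2 D) - l1 y * l2 (b2 D)) *: b1 D
            + (l2 (b1 D) * l1 y - l1 (b1 D) * l2 y) *: b2 D.
Proof. exact: locked_withE. Qed.

Local Notation v := (tangent_proj (b3 D)).
Local Notation r1 := (qf remainder1 v).
Local Notation r2 := (qf remainder2 v).

(** Vectors whose values under the two tangent hyperplanes are proportional to the values of the
two quadrics at [v]: this is the condition for [v] to be a branch direction. The ratio [t2 / t0]
is the parameter of the rational curve. *)
Definition node_vector t0 t2 : 'rV[A]_m :=
  sealed (t2 *: tangent_proj (b4 D)
  + t0 *: ((r1 * l2 (b2 D) - r2 * l1 (b2 D)) *: b1 D
           + (l1 (b1 D) * r2 - l2 (b1 D) * r1) *: b2 D)).

Lemma node_vector_def t0 t2 : node_vector t0 t2 =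
  t2 *: tangent_proj (b4 D)
  + t0 *: ((r1 * l2 (b2 D) - r2 * l1 (b2 D)) *: b1 D
           + (l1 (b1 D) * r2 - l2 (b1 D) * r1) *: b2 D).
Proof. exact: locked_withE. Qed.

Definition curve_point t0 t2 : 'rV[A]_m :=
  sealed (quartic_point remainder1 remainder2 (b0 D) v (node_vector t0 t2)
                        (t0 * tangent_det)).

Lemma curve_point_def t0 t2 : curve_point t0 t2 =
  quartic_point remainder1 remainder2 (b0 D) v (node_vector t0 t2) (t0 * tangent_det).
Proof. exact: locked_withE. Qed.

(** The linear form [al1^2 f(., y) / u] is [al1 N0(y) a + (al1 N1(y) - al2 N0(y)) c], and
[(curve_a : curve_b)] is its root at the curve point. *)
Definition curve_a t0 t2 : A :=
  sealed (al2 * qf (N0 D) (curve_point t0 t2) - al1 * qf (N1 D) (curve_point t0 t2)).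

Lemma curve_a_def t0 t2 :
  curve_a t0 t2 = al2 * qf (N0 D) (curve_point t0 t2) - al1 * qf (N1 D) (curve_point t0 t2).
Proof. exact: locked_withE. Qed.

Definition curve_b t0 t2 : A := sealed (al1 * qf (N0 D) (curve_point t0 t2)).

Lemma curve_b_def t0 t2 : curve_b t0 t2 = al1 * qf (N0 D) (curve_point t0 t2).
Proof. exact: locked_withE. Qed.

Definition fibre t0 t2 : 'M[A]_m := cubic_pencil (curve_a t0 t2) (curve_b t0 t2).

(** Second intersection of the quadric [M] with the line through its point [y] and [w]. *)
Definition residual (M : 'M[A]_m) y w : 'rV[A]_m := (- qf M w) *: y + bf M y w *: w.

Definition bundle_point w : 'rV[A]_m :=
  let t0 := linv (e0 D) w in let t2 := linv (e2 D) w in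
  residual (fibre t0 t2) (curve_point t0 t2) w.

Lemma cubic_pencil_qf a b y : qf (cubic_pencil a b) y =
  a ^+ 3 * qf (N0 D) y + (a ^+ 2 * b) * qf (N1 D) y + (a * b ^+ 2) * qf (N2 D) y
  + b ^+ 3 * qf (N3 D) y.
Proof. by rewrite /cubic_pencil !qfDM !qfZM. Qed.

Lemma bf1_tangent_proj y : l1 (tangent_proj y) = 0.
Proof.
rewrite tangent_proj_def 2!bfDr !bfZr tangent_det_def.
by move: (l1 _) (l1 _) (l1 _) (l2 _) (l2 _) (l2 _) => *; ring.
Qed.

Lemma bf2_tangent_proj y : l2 (tangent_proj y) = 0.
Proof.
rewrite tangent_proj_def 2!bfDr !bfZr tangent_det_def.
by move: (l1 _) (l1 _) (l1 _) (l2 _) (l2 _) (l2 _) => *; ring.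
Qed.

Lemma bf1_node_vector t0 t2 : l1 (node_vector t0 t2) = t0 * tangent_det * r1.
Proof.
rewrite node_vector_def bfDr bfZr bf1_tangent_proj bfZr bfDr !bfZr tangent_det_def.
by ring.
Qed.

Lemma bf2_node_vector t0 t2 : l2 (node_vector t0 t2) = t0 * tangent_det * r2.
Proof.
rewrite node_vector_def bfDr bfZr bf2_tangent_proj bfZr bfDr !bfZr tangent_det_def.
by ring.
Qed.

Lemma curve_point_on_remainders t0 t2 : qf (N0 D) (b0 D) = 0 ->
  qf remainder1 (curve_point t0 t2) = 0 /\ qf remainder2 (curve_point t0 t2) = 0.
Proof.
move=> q0; rewrite curve_point_def; apply: quartic_point_on_quadrics;
  rewrite ?bf1_tangent_proj ?bf2_tangent_proj ?bf1_node_vector ?bf2_node_vector //.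
- by rewrite /remainder1 !qfDM !qfZM q0; ring.
- by rewrite /remainder2 !qfDM !qfZM q0; ring.
Qed.

Lemma fibre_curve_point t0 t2 : qf (N0 D) (b0 D) = 0 ->
  al1 ^+ 2 * qf (fibre t0 t2) (curve_point t0 t2) = 0.
Proof.
move=> q0; case: (curve_point_on_remainders t0 t2 q0).
rewrite /fibre cubic_pencil_qf !curve_a_def !curve_b_def; move: (curve_point t0 t2) => y.
rewrite /remainder1 /remainder2 !qfDM !qfZM.
move: al1 al2 al3 (qf (N0 D) y) (qf (N1 D) y) (qf (N2 D) y) (qf (N3 D) y).
move=> a1 a2 a3 y0 y1 y2 y3 E1 E2.
set xa := a2 * y0 - _; set xb := a1 * y0.
(* The residual linear factor of [f(., y)] vanishes at [(xa, xb)], so only the remainder of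
   the division by [f(., b0) / c] survives. *)
transitivity (xa * xb ^+ 2 *
    (a1 ^+ 2 * y2 + - (a1 * a3) * y0 + - (a1 * a2) * y1 + a2 ^+ 2 * y0)
  + xb ^+ 3 * (a1 ^+ 2 * y3 + - (a1 * a3) * y1 + a2 * a3 * y0)).
  by rewrite /xa /xb; ring.
by rewrite E1 E2; ring.
Qed.

Lemma qf_residual M y w : qf M y = 0 -> qf M (residual M y w) = 0.
Proof. by move=> y0; rewrite /residual !qfE y0; ring. Qed.

(** The second intersection depends only on the line: this allows [w] to be moved along it, onto
any hyperplane that does not contain [y]. *)
Lemma residualDZ M y w a b : qf M y = 0 ->
  residual M y (b *: w + a *: y) = b ^+ 2 *: residual M y w.
Proof.
move=> y0; rewrite /residual !qfE bfyy y0 (bfC _ w y).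
by apply/rowP=> i; rewrite !mxE; ring.
Qed.

Lemma residual_scale M y w a b c : 
  residual (a *: M) (b *: y) (c *: w) = (a * b * c ^+ 2) *: residual M y w.
Proof.
rewrite /residual qfZM bfZM !qfE.
by apply/rowP=> i; rewrite !mxE; ring.
Qed.

Lemma node_vectorZ c t0 t2 : node_vector (c * t0) (c * t2) = c *: node_vector t0 t2.
Proof.
rewrite !node_vector_def; move: (tangent_proj (b4 D)) (_ *: b1 D + _) => u z.
by rewrite scalerDr !scalerA.
Qed.

Lemma curve_pointZ c t0 t2 : curve_point (c * t0) (c * t2) = c ^+ 4 *: curve_point t0 t2.
Proof.
rewrite !curve_point_def node_vectorZ.
move: (node_vector t0 t2) (tangent_proj (b3 D)) tangent_det => w u d.
move: remainder1 remainder2 => P1 P2; rewrite /quartic_point !qfE.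
by apply/rowP=> i; rewrite !mxE; ring.
Qed.

Lemma curve_aZ c t0 t2 : curve_a (c * t0) (c * t2) = c ^+ 8 * curve_a t0 t2.
Proof. by rewrite !curve_a_def curve_pointZ !qfZ; ring. Qed.

Lemma curve_bZ c t0 t2 : curve_b (c * t0) (c * t2) = c ^+ 8 * curve_b t0 t2.
Proof. by rewrite !curve_b_def curve_pointZ !qfZ; ring. Qed.

Lemma cubic_pencilZ c a b : cubic_pencil (c * a) (c * b) = c ^+ 3 *: cubic_pencil a b.
Proof. by rewrite /cubic_pencil; apply/matrixP=> i j; rewrite !mxE; ring. Qed.

Lemma fibreZ c t0 t2 : fibre (c * t0) (c * t2) = c ^+ 24 *: fibre t0 t2.
Proof. by rewrite /fibre curve_aZ curve_bZ cubic_pencilZ -exprM. Qed.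

Lemma linvD e y z : linv e (y + z) = linv e y + linv e z.
Proof. by rewrite /linv mulmxDl mxE. Qed.

Lemma linvZ e c y : linv e (c *: y) = c * linv e y.
Proof. by rewrite /linv -scalemxAl mxE. Qed.

Lemma bundle_pointZ c w : bundle_point (c *: w) = c ^+ 30 *: bundle_point w.
Proof.
rewrite /bundle_point !linvZ curve_pointZ fibreZ residual_scale; congr (_ *: _); ring.
Qed.

End Construction.

Section Naturality.
Variables (A B : comNzRingType) (s : {rmorphism A -> B}) (m : nat).
Variables (D : datum A m).
Local Notation "M ^s" := (map_mx s M) (at level 2, format "M ^s").
Local Notation Ds := (map_datum s D).

Lemma map_qf (M : 'M_m) y : qf M^s y^s = s (qf M y).
Proof. by rewrite !qf_def map_trmx -!map_mxM mxE. Qed.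

Lemma map_bf (M : 'M_m) y z : bf M^s y^s z^s = s (bf M y z).
Proof. by rewrite !bf_def !map_trmx -!map_mxM !mxE rmorphD. Qed.

Lemma map_linv (e : 'cV_m) y : linv e^s y^s = s (linv e y).
Proof. by rewrite /linv -map_mxM mxE. Qed.

Let mapE := (rmorphD, rmorphN, rmorphM, rmorphXn).

Lemma map_quartic_point (R1 R2 : 'M_m) q v w d :
  quartic_point R1^s R2^s q^s v^s w^s (s d) = (quartic_point R1 R2 q v w d)^s.
Proof. by rewrite /quartic_point !map_bf !map_qf !(map_mxD, map_mxZ) !mapE. Qed.

Lemma map_cubic_pencil a b : cubic_pencil Ds (s a) (s b) = (cubic_pencil D a b)^s.
Proof. by rewrite /cubic_pencil !(map_mxD, map_mxZ) ?map_qf ?map_bf !mapE. Qed.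

Lemma map_remainder1 : remainder1 Ds = (remainder1 D)^s.
Proof. by rewrite /remainder1 !(map_mxD, map_mxZ) ?map_qf ?map_bf !mapE. Qed.

Lemma map_remainder2 : remainder2 Ds = (remainder2 D)^s.
Proof. by rewrite /remainder2 !(map_mxD, map_mxZ) ?map_qf ?map_bf !mapE. Qed.

Lemma map_tangent_det : tangent_det Ds = s (tangent_det D).
Proof. by rewrite !tangent_det_def map_remainder1 map_remainder2 !map_bf !mapE. Qed.

Lemma map_tangent_proj y : tangent_proj Ds y^s = (tangent_proj D y)^s.
Proof.
rewrite !tangent_proj_def map_remainder1 map_remainder2 map_tangent_det.
by rewrite !map_bf !(map_mxD, map_mxZ) !mapE.
Qed.

Lemma map_node_vector t0 t2 : node_vector Ds (s t0) (s t2) = (node_vector D t0 t2)^s.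
Proof.
rewrite !node_vector_def map_remainder1 map_remainder2 !map_tangent_proj.
by rewrite !map_bf !map_qf !(map_mxD, map_mxZ) !mapE.
Qed.

Lemma map_curve_point t0 t2 : curve_point Ds (s t0) (s t2) = (curve_point D t0 t2)^s.
Proof.
rewrite !curve_point_def map_remainder1 map_remainder2 map_node_vector map_tangent_proj.
by rewrite map_tangent_det -rmorphM map_quartic_point.
Qed.

Lemma map_curve_a t0 t2 : curve_a Ds (s t0) (s t2) = s (curve_a D t0 t2).
Proof. by rewrite !curve_a_def map_curve_point !map_qf !mapE. Qed.

Lemma map_curve_b t0 t2 : curve_b Ds (s t0) (s t2) = s (curve_b D t0 t2).
Proof. by rewrite !curve_b_def map_curve_point !map_qf !mapE. Qed.

Lemma map_fibre t0 t2 : fibre Ds (s t0) (s t2) = (fibre D t0 t2)^s.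
Proof. by rewrite /fibre map_curve_a map_curve_b map_cubic_pencil. Qed.

Lemma map_residual (M : 'M_m) y t : residual M^s y^s t^s = (residual M y t)^s.
Proof. by rewrite /residual !(map_mxD, map_mxZ) ?map_qf ?map_bf !mapE. Qed.

Lemma map_bundle_point t : bundle_point Ds t^s = (bundle_point D t)^s.
Proof. by rewrite /bundle_point /= !map_linv map_fibre map_curve_point map_residual. Qed.

End Naturality.

(** * Evaluation and gradings of polynomials *)

Section Substitution.
Variables (k : comNzRingType) (N : nat).
Implicit Types (p : {mpoly k[N]}) (m : 'X_{1..N}).

Lemma rmorph_mmap (A B : comNzRingType) (iota : {rmorphism k -> A})
    (s : {rmorphism A -> B}) (h : 'I_N -> A) p :
  s (mmap iota h p) = mmap (s \o iota) (s \o h) p.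
Proof.
rewrite /mmap rmorph_sum; apply: eq_bigr => m _ /=.
rewrite rmorphM /mmap1 rmorph_prod; congr (_ * _).
by apply: eq_bigr => i _; rewrite rmorphXn.
Qed.

Lemma eq_mmap (A : comNzRingType) (iota iota' : k -> A) (h h' : 'I_N -> A) p :
  iota =1 iota' -> h =1 h' -> mmap iota h p = mmap iota' h' p.
Proof.
move=> e1 e2; rewrite /mmap; apply: eq_bigr => m _.
by rewrite e1 (mmap1_eq _ e2).
Qed.

Lemma mmap_vars p : mmap (@mpolyC N k) (fun i => 'X_i) p = p.
Proof.
rewrite [RHS]mpolyE /mmap; apply: eq_bigr => m _.
by rewrite mmap1_id mul_mpolyC.
Qed.

Lemma mmap_ideal (K : fieldType) (iota : {rmorphism k -> {poly K}})
    (c : {poly K}) (h h' : 'I_N -> {poly K}) p :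
  (forall i, c %| h i - h' i) -> c %| mmap iota h p - mmap iota h' p.
Proof.
move=> hh; rewrite /mmap -sumrB; apply: (big_ind (fun z => c %| z)) => //.
- by move=> *; apply: dvdp_add.
move=> m _; rewrite -mulrBr; apply: dvdp_mull.
rewrite /mmap1; apply: (big_ind2 (fun z z' => c %| z - z')) => //.
- by rewrite subrr dvdp0.
- move=> x1 x2 y1 y2 h1 h2.
  have -> : x1 * y1 - x2 * y2 = (x1 - x2) * y1 + x2 * (y1 - y2) by ring.
  by apply: dvdp_add; [apply: dvdp_mulr | apply: dvdp_mull].
by move=> i _; rewrite subrXX; apply: dvdp_mulr.
Qed.

End Substitution.

(** The factors of a monomial are monomials; this is what makes gradings pass to factors. *)
Lemma monomial_factor (R : idomainType) (c : R) d (P Q : {poly R}) :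
  c != 0 -> P * Q = c%:P * 'X^d ->
  exists i j a b, [/\ (i + j = d)%N, P = a%:P * 'X^i & Q = b%:P * 'X^j].
Proof.
move=> c0; elim: d P Q => [|d IH] P Q.
  rewrite expr0 mulr1 => E.
  have : size (P * Q) == 1%N by rewrite E size_polyC c0.
  rewrite size_mul_eq1 => /andP[/size_poly1P[a _ ->] /size_poly1P[b _ ->]].
  by exists 0%N, 0%N, a, b; rewrite !expr0 !mulr1.
move=> E; have : root (P * Q) 0.
  by rewrite /root E hornerM hornerXn expr0n mulr0.
rewrite rootM => /orP[] /factor_theorem[U]; rewrite subr0 => eU.
- have [|i [j [a [b [eij e1 e2]]]]] := IH U Q.
    apply: (mulIf (negbT (polyX_eq0 R))); transitivity (P * Q); first by rewrite eU; ring.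
    by rewrite E exprSr mulrA.
  by exists i.+1, j, a, b; rewrite addSn eij eU {1}e1 exprSr mulrA; split.
- have [|i [j [a [b [eij e1 e2]]]]] := IH P U.
    apply: (mulIf (negbT (polyX_eq0 R))); transitivity (P * Q); first by rewrite eU; ring.
    by rewrite E exprSr mulrA.
  by exists i, j.+1, a, b; rewrite addnS eij eU {1}e2 exprSr mulrA; split.
Qed.

Section WeightedDegree.
Variables (k : fieldType) (N : nat) (omega : 'I_N -> nat).

Definition wdeg (m : 'X_{1..N}) := (\sum_(i < N) omega i * m i)%N.

(** Scaling each variable by a power of a new indeterminate, so that homogeneity becomes an
identity between polynomials in this indeterminate. *)
Definition wscale : {mpoly k[N]} -> {poly {mpoly k[N]}} :=
  mmap (polyC \o @mpolyC N k) (fun i => 'X^(omega i) * ('X_i)%:P).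

Lemma wscaleE p :
  wscale p = \sum_(m <- msupp p) (p@_m *: 'X_[m])%:P * 'X^(wdeg m).
Proof.
rewrite /wscale /mmap; apply: eq_bigr => m _ /=.
rewrite -mul_mpolyC polyCM -mulrA; congr (_ * _).
rewrite /mmap1 (eq_bigr (fun i => 'X^(omega i * m i) * (('X_i)^+(m i))%:P)); last first.
  by move=> i _; rewrite exprMn -exprM -polyC_exp.
rewrite big_split /= mulrC /wdeg; congr (_ * _).
  by rewrite -rmorph_prod -(mmap1_id k m).
by elim/big_rec2: _ => [|i u v _ ->]; rewrite ?expr0 // exprD.
Qed.

Lemma coef_wscale p d m : ((wscale p)`_d)@_m = p@_m * (wdeg m == d)%:R.
Proof.
rewrite wscaleE coef_sum raddf_sum /=.
under eq_bigr => m' _ do rewrite coefCM coefXn.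
have [mp | mp] := boolP (m \in msupp p); last first.
  rewrite memN_msupp_eq0 // mul0r big_seq big1 // => m' m'p.
  case: eqP => _; rewrite ?mulr0 ?mcoeff0 // mulr1 mcoeffZ mcoeffX.
  by case: eqP => [e|_]; [rewrite -e m'p in mp | rewrite mulr0].
rewrite (bigD1_seq m) //= big1 => [|m' ne].
  rewrite addr0 eq_sym; case: eqP => _; rewrite ?mulr0 ?mcoeff0 //.
  by rewrite !mulr1 mcoeffZ mcoeffX eqxx mulr1.
case: eqP => _; rewrite ?mulr0 ?mcoeff0 // mulr1 mcoeffZ mcoeffX.
by rewrite (negbTE ne) mulr0.
Qed.

Lemma wscale_homog p d : wscale p = p%:P * 'X^d ->
  {in msupp p, forall m, wdeg m = d}.
Proof.
move=> e m mp; have := coef_wscale p d m.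
rewrite e coefCM coefXn eqxx mulr1; case: eqP => // _; rewrite mulr0 => z.
by move: mp; rewrite mcoeff_msupp z eqxx.
Qed.

Lemma horner_wscale p : (wscale p).[1] = p.
Proof.
rewrite wscaleE horner_sum [RHS]mpolyE; apply: eq_bigr => m _.
by rewrite hornerM hornerC hornerXn expr1n mulr1.
Qed.

Lemma wscale_factor p q d : p * q != 0 -> wscale (p * q) = (p * q)%:P * 'X^d ->
  exists i j, [/\ (i + j = d)%N, wscale p = p%:P * 'X^i & wscale q = q%:P * 'X^j].
Proof.
move=> pq0 e.
have eM : wscale p * wscale q = (p * q)%:P * 'X^d by rewrite -e /wscale rmorphM.
have [i [j [a [b [eij eP eQ]]]]] := monomial_factor pq0 eM.
have at1 (r c : {mpoly k[N]}) l : wscale r = c%:P * 'X^l -> wscale r = r%:P * 'X^l.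
  move=> er; rewrite er; congr (_ * _); congr polyC.
  rewrite -[RHS](horner_wscale r) er.
  by rewrite hornerM hornerC hornerXn expr1n mulr1.
have eP' : wscale p = (a : {mpoly k[N]})%:P * 'X^i by rewrite eP; congr (_ * _).
have eQ' : wscale q = (b : {mpoly k[N]})%:P * 'X^j by rewrite eQ; congr (_ * _).
by exists i, j; split; [exact: eij | apply: at1 eP' | apply: at1 eQ'].
Qed.

End WeightedDegree.

(** * From equations of bidegree (3,2) to pencils of quadrics *)

Section Exponents.
Variable N : nat.
Implicit Types mu : 'I_N -> nat.

Lemma sum_succ mu d : (\sum_i mu i = d.+1)%N ->
  exists a mu', (\sum_i mu' i = d)%N /\ forall i, mu i = ((i == a) + mu' i)%N.
Proof.
move=> e; have [a a0] : exists a, (0 < mu a)%N.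
  apply/existsP; rewrite -[X in is_true X]negbK negb_exists; apply/negP => /forallP z.
  by move: e; rewrite big1 // => i _; apply/eqP; rewrite -leqn0 leqNgt.
exists a, (fun i => mu i - (i == a))%N; split=> [|i]; last first.
  by rewrite subnKC //; case: eqP => // ->.
move: e; rewrite (bigD1 a) //= => e.
rewrite (bigD1 a) //= eqxx.
under eq_bigr => i /negbTE -> do rewrite subn0.
lia.
Qed.

Lemma sum_eq1 mu : (\sum_i mu i = 1)%N -> exists a, forall i, mu i = (i == a) :> nat.
Proof.
case/sum_succ=> a [mu' [z e]]; exists a => i; rewrite e.
move/eqP: z; rewrite sum_nat_eq0 => /forallP/(_ i)/eqP ->.
by rewrite addn0.
Qed.

Lemma sum_eq2 mu : (\sum_i mu i = 2)%N ->
  exists a b, forall i, mu i = ((i == a) + (i == b))%N.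
Proof.
case/sum_succ=> a [mu' [/sum_eq1[b z] e]]; exists a, b => i.
by rewrite e z.
Qed.

Lemma prod_exp1 (A : comNzRingType) (h : 'I_N -> A) a :
  \prod_i h i ^+ (i == a) = h a.
Proof.
rewrite (bigD1 a) //= eqxx big1 ?mulr1 ?expr1 // => i /negbTE ->.
by rewrite expr0.
Qed.

End Exponents.

Section Points.
Variables (k : fieldType) (n : nat).
Implicit Types (m : 'X_{1..2 + n.+1}) (f : {mpoly k[2 + n.+1]}).

Definition xdeg m := (\sum_(i < 2) m (lshift n.+1 i))%N.
Definition ydeg m := (\sum_(j < n.+1) m (rshift 2 j))%N.

Lemma mmap1_row (A : comNzRingType) (x : 'rV[A]_2) (y : 'rV[A]_n.+1) m :
  mmap1 (row_mx x y 0) m =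
  (\prod_(i < 2) x 0 i ^+ m (lshift n.+1 i)) * \prod_(j < n.+1) y 0 j ^+ m (rshift 2 j).
Proof.
rewrite /mmap1 big_split_ord /=; congr (_ * _); apply: eq_bigr => i _.
  by rewrite row_mxEl.
by rewrite row_mxEr.
Qed.

Lemma bihomogeneousZ (A : comNzRingType) (iota : {rmorphism k -> A}) d e f
    (x : 'rV[A]_2) (y : 'rV[A]_n.+1) a b : bihomogeneous d e f ->
  mmap iota (row_mx (a *: x) (b *: y) 0) f =
  a ^+ d * b ^+ e * mmap iota (row_mx x y 0) f.
Proof.
move=> hf; rewrite /mmap mulr_sumr; apply: eq_big_seq => m /hf[<- <-].
have aux N (z : 'rV[A]_N) c (mu : 'I_N -> nat) :
   \prod_i (c *: z) 0 i ^+ mu i = c ^+ (\sum_i mu i) * \prod_i z 0 i ^+ mu i.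
  under eq_bigr => i _ do rewrite mxE exprMn.
  by rewrite big_split /=; congr (_ * _); elim/big_rec2: _ => [|i u v _ ->];
    rewrite ?expr0 // exprD.
rewrite !mmap1_row !aux mulrACA. exact: mulrCA.
Qed.

(** The quadratic monomial induced by [m] in [y], represented by a matrix unit. This
non-symmetric choice avoids dividing by 2. *)
Definition ymatrix m : 'M[k]_n.+1 :=
  if [pick jl : 'I_n.+1 * 'I_n.+1 |
        [forall j, m (rshift 2 j) == (j == jl.1) + (j == jl.2)]%N] is Some jl
  then delta_mx jl.1 jl.2 else 0.

Lemma qf_ymatrix (A : comNzRingType) (iota : {rmorphism k -> A}) (y : 'rV[A]_n.+1) m :
  ydeg m = 2 ->
  qf (map_mx iota (ymatrix m)) y = \prod_(j < n.+1) y 0 j ^+ m (rshift 2 j).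
Proof.
case/sum_eq2=> a [b hab]; rewrite /ymatrix.
case: pickP => [[c d] /forallP /= hcd | /(_ (a, b))]; last first.
  by move/forallP; case=> j; rewrite hab.
rewrite map_delta_mx qf_def.
under eq_bigr => j _ do rewrite (eqP (hcd j)) exprD.
rewrite big_split /= !prod_exp1.
rewrite mxE (bigD1 d) //= big1 => [|i /negbTE ne].
  rewrite mxE mxE (bigD1 c) //= big1 => [|i /negbTE ne].
    by rewrite !mxE !eqxx mulr1 !addr0.
  by rewrite !mxE ne mulr0.
rewrite mxE big1 ?mul0r // => j _.
by rewrite !mxE ne andbF mulr0.
Qed.

End Points.

Section CoefficientMatrices.
Variables (k : fieldType) (n : nat) (P : 'M[k]_2).
Variables (b : 'M[k]_(5, n.+1)) (e : 'M[k]_(n.+1, 5)).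
Implicit Types (m : 'X_{1..2 + n.+1}) (f : {mpoly k[2 + n.+1]}).

(** The rows of [P] are coordinate vectors of the new base points [(1 : 0)] and [(0 : 1)] of
[P^1]. *)
Definition base_point (A : comNzRingType) (iota : k -> A) (a c : A) : 'rV[A]_2 :=
  a *: map_mx iota (row 0 P) + c *: map_mx iota (row 1 P).

(** Coefficient of [a^(3-r) c^r] in [x_0^(3-i) x_1^i] after the change of coordinates: the
product of the three linear factors, the first [i] of which are [x_1]. *)
Definition cubic_coef (i r : nat) : k :=
  let u j := P 0 (if (j < i)%N then 1 else 0) in
  let v j := P 1 (if (j < i)%N then 1 else 0) in
  match r with
  | 0%N => u 0%N * u 1%N * u 2%N
  | 1%N => v 0%N * u 1%N * u 2%N + u 0%N * v 1%N * u 2%N + u 0%N * u 1%N * v 2%N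
  | 2%N => v 0%N * v 1%N * u 2%N + v 0%N * u 1%N * v 2%N + u 0%N * v 1%N * v 2%N
  | _ => v 0%N * v 1%N * v 2%N
  end.

Arguments cubic_coef : simpl never.

Definition monomial_matrix r m : 'M[k]_n.+1 :=
  if (xdeg m == 3) && (ydeg m == 2)
  then cubic_coef (m (lshift n.+1 1%R)) r *: ymatrix k m else 0.

(** Monomials of degree at most 5 are enough, since the total degree is 3 + 2. *)
Definition coef_matrix r f : 'M[k]_n.+1 :=
  \sum_(m : 'X_{1..(2 + n.+1) < 6}) f@_m *: monomial_matrix r m.

Definition datum_of f : datum k n.+1 :=
  Datum (coef_matrix 0 f) (coef_matrix 1 f) (coef_matrix 2 f) (coef_matrix 3 f)
    (row 0 b) (row 1 b) (row 2%:R b) (row 3%:R b) (row 4%:R b)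
    (col 0 e) (col 2%:R e).

Lemma base_point_cubic (A : comNzRingType) (iota : {rmorphism k -> A}) (a c : A) i :
  (i <= 3)%N ->
  base_point iota a c 0 0 ^+ (3 - i) * base_point iota a c 0 1 ^+ i =
  a ^+ 3 * iota (cubic_coef i 0) + (a ^+ 2 * c) * iota (cubic_coef i 1)
  + (a * c ^+ 2) * iota (cubic_coef i 2) + c ^+ 3 * iota (cubic_coef i 3).
Proof.
by case: i => [|[|[|[|]]]] // _; rewrite !mxE /cubic_coef /= !(rmorphD, rmorphM); ring.
Qed.

Lemma qf_sum (A : comNzRingType) d (I : Type) (s : seq I) (F : I -> 'M[A]_d) y :
  qf (\sum_(i <- s) F i) y = \sum_(i <- s) qf (F i) y.
Proof.
rewrite qf_def mulmx_sumr mulmx_suml summxE.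
by apply: eq_bigr => i _; rewrite qf_def.
Qed.

Lemma qf_coef_matrix (A : comNzRingType) (iota : {rmorphism k -> A}) r f y :
  qf (map_mx iota (coef_matrix r f)) y =
  \sum_(m : 'X_{1..(2 + n.+1) < 6}) iota f@_m * qf (map_mx iota (monomial_matrix r m)) y.
Proof.
rewrite /coef_matrix map_mx_sum qf_sum; apply: eq_bigr => m _.
by rewrite map_mxZ qfZM.
Qed.

Lemma mmap_cubic_pencil (A : comNzRingType) (iota : {rmorphism k -> A}) a c y f :
  bihomogeneous 3 2 f ->
  mmap iota (row_mx (base_point iota a c) y 0) f =
  qf (cubic_pencil (map_datum iota (datum_of f)) a c) y.
Proof.
move=> hf; rewrite cubic_pencil_qf /= !qf_coef_matrix !mulr_sumr -!big_split /=.
have sz : (msize f <= 6)%N.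
  rewrite msizeE; apply/bigmax_leqP_seq => m mf _.
  by rewrite mdegE big_split_ord /=; case: (hf m mf) => -> ->.
rewrite (mmapE 6 sz); apply: eq_bigr => -[m hm] _ /=.
have [mf | /memN_msupp_eq0 ->] := boolP (m \in msupp f); last first.
  by rewrite rmorph0 !mul0r !mulr0 !addr0.
have [hx hy] := hf m mf.
have le3 : (m (lshift n.+1 1%R) <= 3)%N.
  by rewrite -hx (bigD1 1%R) //= leq_addr.
have e01 : lift ord0 ord0 = 1 :> 'I_2 by apply/val_inj.
rewrite /monomial_matrix /xdeg /ydeg hx hy !eqxx /= !map_mxZ !qfZM.
rewrite qf_ymatrix // mmap1_row !big_ord_recl big_ord0 mulr1.
have -> : m (lshift n.+1 ord0) = (3 - m (lshift n.+1 1%R))%N.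
  by rewrite -hx !big_ord_recl big_ord0 addn0 e01 addnK.
rewrite e01 base_point_cubic //; ring.
Qed.

End CoefficientMatrices.

(** * The nondegeneracy conditions *)

Section Conditions.
Variables (A : comNzRingType) (m : nat) (D : datum A m).
Implicit Types (s : A) (w : 'rV[A]_m).

(** Nonzero when the curve point over [s] lies outside the hyperplane [e2 = s e0] from which the
parametrization projects to the fibre over [s]. *)
Definition gap s : A :=
  linv (e2 D) (curve_point D 1 s) - s * linv (e0 D) (curve_point D 1 s).

(** Up to a factor, the value of [e0] at the point in which the hyperplane [e2 = s e0] meets the
line through [w] and the curve point. *)
Definition cross s w : A :=
  linv (e0 D) w * linv (e2 D) (curve_point D 1 s)
  - linv (e2 D) w * linv (e0 D) (curve_point D 1 s).

(** Resultant of the restrictions to the line [w + T z] of the quadric [M] and of its tangent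
hyperplane at [y]. *)
Definition resultant_at (M : 'M[A]_m) y w z : A :=
  qf M (bf M y z *: w + (- bf M y w) *: z).

Definition good_line s w : A :=
  gap s * cross s w * resultant_at (fibre D 1 s) (curve_point D 1 s) w (b0 D)
  * qf (fibre D 1 s) (b0 D).

(** Its determinant detects the linear independence of [N0, ..., N3]; the four vectors are
chosen so that this determinant is a unit for the example below. *)
Definition value_matrix : 'M[A]_4 :=
  \matrix_(i, j) qf (nth 0 [:: N0 D; N1 D; N2 D; N3 D] i)
                    (nth 0 [:: b0 D; b3 D; b1 D; b0 D + b1 D] j).

(** Nonzero when the curve has different images in [P^1] at the parameters 0 and 1. *)
Definition moving_base : A := curve_a D 1 0 * curve_b D 1 1 - curve_b D 1 0 * curve_a D 1 1.

Definition good_datum : A :=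
  \det value_matrix * moving_base * good_line 1 (b2 D)
  * linv (e0 D) (bundle_point D (b0 D + b2 D)).

End Conditions.

Section ConditionsNaturality.
Variables (A B : comNzRingType) (s : {rmorphism A -> B}) (m : nat).
Variables (D : datum A m).
Local Notation "M ^s" := (map_mx s M) (at level 2, format "M ^s").
Local Notation Ds := (map_datum s D).

Lemma map_gap t : gap Ds (s t) = s (gap D t).
Proof. by rewrite /gap -(rmorph1 s) map_curve_point /= !map_linv rmorphB rmorphM. Qed.

Lemma map_cross t w : cross Ds (s t) w^s = s (cross D t w).
Proof. by rewrite /cross -(rmorph1 s) map_curve_point /= !map_linv rmorphB !rmorphM. Qed.

Lemma map_resultant_at (M : 'M_m) y w z :
  resultant_at M^s y^s w^s z^s = s (resultant_at M y w z).
Proof. by rewrite /resultant_at !map_bf -rmorphN -!map_mxZ -map_mxD map_qf. Qed.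

Lemma map_good_line t w : good_line Ds (s t) w^s = s (good_line D t w).
Proof.
rewrite /good_line map_gap map_cross -(rmorph1 s) map_curve_point map_fibre /=.
by rewrite map_resultant_at map_qf !rmorphM.
Qed.

Lemma map_value_matrix : value_matrix Ds = (value_matrix D)^s.
Proof.
apply/matrixP=> i j; rewrite !mxE -map_qf; congr qf.
  by case: i => [[|[|[|[|i]]]] hi].
by case: j => [[|[|[|[|j]]]] hj] //=; rewrite map_mxD.
Qed.

Lemma map_moving_base : moving_base Ds = s (moving_base D).
Proof.
by rewrite /moving_base -(rmorph0 s) -(rmorph1 s) !map_curve_a !map_curve_b rmorphB !rmorphM.
Qed.

Lemma map_good_datum : good_datum Ds = s (good_datum D).
Proof.
rewrite /good_datum map_value_matrix det_map_mx map_moving_base -(rmorph1 s) map_good_line /=.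
by rewrite -map_mxD map_bundle_point map_linv !rmorphM.
Qed.

End ConditionsNaturality.

Lemma map_datum_comp (A B C : comNzRingType) (s : A -> B) (t : B -> C) m (D : datum A m) :
  map_datum t (map_datum s D) = map_datum (t \o s) D.
Proof. by rewrite /map_datum /= -!map_mx_comp. Qed.

Lemma eq_map_datum (A B : comNzRingType) (s t : A -> B) m (D : datum A m) :
  s =1 t -> map_datum s D = map_datum t D.
Proof. by move=> e; rewrite /map_datum !(eq_map_mx _ e). Qed.

Lemma map_datum_id (A : comNzRingType) m (D : datum A m) : map_datum id D = D.
Proof. by case: D => *; rewrite /map_datum !map_mx_id. Qed.

Lemma qf0 (A : comNzRingType) m (M : 'M[A]_m) : qf M 0 = 0.
Proof. by rewrite -(scale0r 0) qfZ expr2 !mul0r. Qed.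

(** * Divisibility on lines *)

Section Lines.
Variables (A : idomainType) (m : nat).
Implicit Types (w e : 'rV[A]_m) (N : 'M[A]_m).
Local Notation "V ^C" := (map_mx polyC V).

Definition line w e : 'rV[{poly A}]_m := w^C + 'X *: e^C.

Lemma line_qf N w e :
  qf N^C (line w e) = (qf N e)%:P * 'X^2 + ((bf N w e)%:P * 'X + (qf N w)%:P).
Proof. by rewrite /line !qfE !map_qf !map_bf; ring. Qed.

Lemma line_qf_low N w e : (size ((bf N w e)%:P * 'X + (qf N w)%:P)%R <= 2)%N.
Proof. by rewrite size_MXaddC; case: ifP => // _; rewrite ltnS size_polyC_leq1. Qed.

Lemma size_line_qf N w e : qf N e != 0 -> size (qf N^C (line w e)) = 3.
Proof.
move=> a0; have sX : size ((qf N e)%:P * 'X^2) = 3%N by rewrite size_Cmul // size_polyXn.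
by rewrite line_qf size_polyDl sX // ltnS line_qf_low.
Qed.

Lemma lead_line_qf N w e : qf N e != 0 -> lead_coef (qf N^C (line w e)) = qf N e.
Proof.
move=> a0; have sX : size ((qf N e)%:P * 'X^2) = 3%N by rewrite size_Cmul // size_polyXn.
rewrite line_qf lead_coefDl ?sX ?ltnS ?line_qf_low //.
by rewrite lead_coefM lead_coefC lead_coefXn mulr1.
Qed.

End Lines.

Lemma map_line (A B : idomainType) (s : {rmorphism A -> B}) m (w e : 'rV[A]_m) :
  map_mx (map_poly s) (line w e) = line (map_mx s w) (map_mx s e).
Proof. by apply/rowP=> i; rewrite !mxE rmorphD rmorphM /= !map_polyC map_polyX. Qed.

Definition pencil_equation (k : fieldType) n (P : 'M[k]_2) (D : datum k n.+1)
    (f : {mpoly k[2 + n.+1]}) :=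
  forall (A : comNzRingType) (iota : {rmorphism k -> A}) a c (y : 'rV[A]_n.+1),
  mmap iota (row_mx (base_point P iota a c) y 0) f =
  qf (cubic_pencil (map_datum iota D) a c) y.

(** Vanishing at the universal point of the image is the same as vanishing at the image of every
point over every ring, without exceptions on the base locus. *)
Definition vanishes_on_image (k : fieldType) n (P : 'M[k]_2) (D : datum k n.+1)
    (g : {mpoly k[2 + n.+1]}) :=
  forall (A : comNzRingType) (iota : {rmorphism k -> A}) (t : 'rV[A]_n.+1),
  let DA := map_datum iota D in
  let t0 := linv (e0 DA) t in let t2 := linv (e2 DA) t in
  mmap iota (row_mx (base_point P iota (curve_a DA t0 t2) (curve_b DA t0 t2))
                    (bundle_point DA t) 0) g = 0.

Section Dominance.
Variables (k : fieldType) (n : nat) (P : 'M[k]_2) (D : datum k n.+1).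
Hypothesis N0b0 : qf (N0 D) (b0 D) = 0.
Hypothesis moves : moving_base D != 0.
Variables (g : {mpoly k[2 + n.+1]}) (dx dy : nat).
Hypothesis bihom_g : bihomogeneous dx dy g.
Hypothesis g_image : vanishes_on_image P D g.

Lemma base_pointZ (A : comNzRingType) (iota : {rmorphism k -> A}) (c a b : A) :
  base_point P iota (c * a) (c * b) = c *: base_point P iota a b.
Proof. by rewrite /base_point scalerDr !scalerA. Qed.

Lemma N1b0_neq0 : qf (N1 D) (b0 D) != 0.
Proof.
apply: contraNneq moves => z.
by rewrite /moving_base !curve_a_def !curve_b_def z !mul0r !mulr0 subrr.
Qed.

Lemma fibre_on (A : idomainType) (iota : {rmorphism k -> A}) t0 t2 :
  let DA := map_datum iota D in qf (fibre DA t0 t2) (curve_point DA t0 t2) = 0.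
Proof.
move=> DA; have := @fibre_curve_point A _ DA t0 t2.
rewrite /= !map_qf N0b0 rmorph0 => /(_ erefl)/eqP.
by rewrite mulf_eq0 expf_eq0 /= fmorph_eq0 (negbTE N1b0_neq0) => /eqP.
Qed.

(** All the points of the fibre over [s] are reached: the line through the curve point and [w]
meets the hyperplane [e2 = s e0] in a point [t] whose image has this fibre as its base, and
replacing [w] by [t] does not change the second intersection. *)
Lemma image_fibre (A : idomainType) (iota : {rmorphism k -> A}) (s : A) (w : 'rV[A]_n.+1) :
  let DA := map_datum iota D in
  gap DA s != 0 -> cross DA s w != 0 ->
  mmap iota (row_mx (base_point P iota (curve_a DA 1 s) (curve_b DA 1 s))
                    (residual (fibre DA 1 s) (curve_point DA 1 s) w) 0) g = 0.
Proof.
move=> DA; have on := fibre_on iota 1 s; rewrite -/DA in on.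
rewrite /gap /cross; have := g_image iota; rewrite /= -/DA.
set M := fibre DA 1 s in on *; set Y := curve_point DA 1 s in on *.
set e0w := linv _ w; set e2w := linv _ w => gi.
set dl := _ - _; set c := _ - _ => dl0 c0.
pose t := dl *: w + (- (e2w - s * e0w)) *: Y.
have et0 : linv (map_mx iota (e0 D)) t = c * 1.
  by rewrite /t linvD !linvZ -/e0w /c /dl; ring.
have et2 : linv (map_mx iota (e2 D)) t = c * s.
  by rewrite /t linvD !linvZ -/e2w /c /dl; ring.
move: (gi t); rewrite /bundle_point /= et0 et2 curve_aZ curve_bZ fibreZ curve_pointZ -/M -/Y.
rewrite -[X in residual _ _ X]scale1r residual_scale expr1n mulr1 /t residualDZ //.
rewrite scalerA base_pointZ (bihomogeneousZ _ _ _ _ _ bihom_g) => /eqP.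
rewrite mulf_eq0 => /orP[|/eqP //].
by rewrite mulf_eq0 !expf_eq0 mulf_eq0 mulf_eq0 !expf_eq0 (negbTE c0) (negbTE dl0) /= !andbF.
Qed.

Section OnALine.
Variables (L : fieldType) (iota : {rmorphism k -> L}) (s : L) (w : 'rV[L]_n.+1).
Local Notation DL := (map_datum iota D).
Local Notation iotaT := (polyC \o iota).
Local Notation M := (fibre DL 1 s).
Local Notation Y := (curve_point DL 1 s).
Local Notation "V ^C" := (map_mx polyC V).

Local Notation lineT := (line w (b0 DL)).

(** A Bezout relation: [be (w + T e)] is the vector [be w - bw e] of the tangent hyperplane plus
a multiple of the tangent form, so [be^2] times the quadric is congruent to the resultant. *)
Lemma coprime_line : resultant_at M Y w (b0 DL) != 0 ->
  coprimep (qf M^C lineT) (bf M^C Y^C lineT).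
Proof.
set e := b0 DL => r0.
set be := bf M Y e; set bw := bf M Y w.
have el : bf M^C Y^C lineT = bw%:P + 'X * be%:P by rewrite /line !bfE !map_bf.
set l := bf _ _ _ in el *.
have key : be%:P *: lineT = (be *: w + (- bw) *: e)^C + l *: e^C.
  rewrite el /line -/e map_mxD !map_mxZ /= rmorphN /=.
  by apply/rowP=> i; rewrite !mxE; ring.
have := congr1 (qf M^C) key; rewrite qfZ [RHS]qfD map_qf bfZr qfZ.
rewrite -/(resultant_at M Y w e) => bez.
apply/Bezout_coprimepP.
exists (be%:P ^+ 2, - (bf M^C (be *: w + (- bw) *: e)^C e^C + l * qf M^C e^C)) => /=.
rewrite (_ : _ + _ = (resultant_at M Y w e)%:P); first by rewrite polyC_eqp1.
by rewrite bez; ring.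
Qed.

(** Modulo the quadric, the second intersection point of the line through [Y] and [w] is [w]
times the tangent form; so [g] times a power of the tangent form is divisible by the quadric,
and the tangent form is prime to it. *)
Lemma line_dvd : good_line DL s w != 0 ->
  qf M^C lineT %|
  mmap iotaT (row_mx (base_point P iotaT (curve_a DL 1 s)%:P (curve_b DL 1 s)%:P) lineT 0) g.
Proof.
rewrite /good_line !mulf_eq0 !negb_or -!andbA => /and4P[gp cr rs _].
have eD : map_datum iotaT D = map_datum polyC DL by rewrite map_datum_comp.
have eY : curve_point (map_datum polyC DL) 1 s%:P = Y^C by rewrite -map_curve_point rmorph1.
have eM : fibre (map_datum polyC DL) 1 s%:P = M^C by rewrite -map_fibre rmorph1.
have ea : curve_a (map_datum polyC DL) 1 s%:P = (curve_a DL 1 s)%:P by rewrite -map_curve_a rmorph1.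
have eb : curve_b (map_datum polyC DL) 1 s%:P = (curve_b DL 1 s)%:P by rewrite -map_curve_b rmorph1.
have := @image_fibre {poly L} iotaT s%:P lineT.
rewrite /= eD map_gap polyC_eq0 eY eM ea eb => /(_ gp) im.
have {}im := im _.
rewrite -(@Gauss_dvdpr _ _ (bf M^C Y^C lineT ^+ dy)); last first.
  by rewrite coprimep_expr // coprime_line.
have := bihomogeneousZ iotaT (base_point P iotaT (curve_a DL 1 s)%:P (curve_b DL 1 s)%:P)
  lineT 1 (bf M^C Y^C lineT) bihom_g.
rewrite scale1r expr1n mul1r => <-.
have /im e0 : cross (map_datum polyC DL) s%:P lineT != 0.
  apply: contraNneq cr => z.
  have := congr1 (horner_eval 0) z; rewrite -map_cross rmorph0.
  have hid : horner_eval 0 \o (@polyC L) =1 id by move=> c; rewrite /= /horner_eval hornerC.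
  rewrite map_datum_comp (eq_map_datum _ hid) map_datum_id /= {1}/horner_eval hornerC.
  suff -> : map_mx (horner_eval 0) lineT = w by move=> ->.
  by apply/rowP=> i; rewrite !mxE /horner_eval /= !hornerE.
rewrite -[X in _ %| X]subr0 -e0.
apply: mmap_ideal => i; rewrite !mxE; case: splitP => j _; first by rewrite subrr dvdp0.
rewrite !mxE -dvdpNr opprB addrK mulNr dvdpNr.
by apply: dvdp_mulr.
Qed.

End OnALine.
End Dominance.

(** * Divisibility at the generic point *)

Lemma pseudo_division (R : idomainType) (p1 p2 : {poly R}) : size p1 = 3 ->
  exists N h r1 r0,
    lead_coef p1 ^+ N *: p2 = h * p1 + (r1%:P * 'X + r0%:P).
Proof.
move=> s1; exists (Pdiv.Idomain.scalp p2 p1), (Pdiv.Idomain.divp p2 p1).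
set r := Pdiv.Idomain.modp p2 p1.
exists r`_1, r`_0; rewrite Pdiv.Idomain.divp_eq; congr (_ + _).
have sr : (size r <= 2)%N.
  by have := Pdiv.Idomain.ltn_modp p2 p1; rewrite -size_poly_gt0 s1 ltnS.
apply/polyP=> -[|[|i]]; rewrite coefD coefMX !coefC /= ?add0r ?addr0 //.
by rewrite nth_default // (leq_trans sr).
Qed.

Section Pigeonhole.
Variable k : fieldType.
Hypothesis k_infinite : infinite_field k.

(** Otherwise more distinct elements than the degree would all be roots. *)
Lemma exists_nonroot (q : {poly k}) : q != 0 -> exists s, q.[s] != 0.
Proof.
move=> q0; suff [rs us [ss rr]] : exists2 rs : seq k, uniq rs & size rs = size q /\
    ((exists s, q.[s] != 0) \/ all (root q) rs).
  case: rr => // rr; have := max_poly_roots q0 rr us.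
  by rewrite ss ltnn.
elim: (size q) => [|N [rs us [ss rr]]]; first by exists [::]; split=> //; right.
have [c cs] := k_infinite rs; exists (c :: rs); first by rewrite /= cs.
split; first by rewrite /= ss.
case: rr => [|rr]; [by left|].
have [rc|nc] := boolP (root q c); last by left; exists c.
by right; rewrite /= rc.
Qed.

(** A nonconstant rational function [u / v] takes infinitely many values on [k]: given finitely
many values, the product of the [u - t v] and of [v] is a nonzero polynomial, and a point at
which it does not vanish gives a new value. *)
Lemma ratio_pigeonhole (L : fieldType) (iota : {rmorphism k -> L}) (u v : {poly k})
    (rho : {poly L}) :
  u.[0] * v.[1] - v.[0] * u.[1] != 0 ->
  (forall s, v.[s] != 0 -> root rho (iota (u.[s] / v.[s]))) -> rho = 0.
Proof.
move=> uv hr; apply/eqP/negPn/negP => rho0.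
suff [ts us [ss rr]] : exists2 ts : seq k, uniq ts &
    size ts = size rho /\ all (fun t => root rho (iota t)) ts.
  have : (size (map iota ts) < size rho)%N.
    apply: max_poly_roots => //; first by rewrite all_map.
    by rewrite map_inj_uniq //; apply: fmorph_inj.
  by rewrite size_map ss ltnn.
have notprop t : u - t%:P * v != 0.
  apply: contraNneq uv => /(subr0_eq) ->.
  by rewrite !hornerM !hornerC; apply/eqP; ring.
have v0 : v != 0 by apply: contraNneq uv => ->; rewrite !horner0 mulr0 mul0r subrr.
elim: (size rho) => [|N [ts us [ss rr]]]; first by exists [::].
have : v * \prod_(t <- ts) (u - t%:P * v) != 0.
  rewrite mulf_neq0 // prodf_seq_neq0; apply/allP => t _ /=; exact: notprop.
case/exists_nonroot=> s; rewrite hornerM horner_prod mulf_eq0 negb_or => /andP[vs].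
rewrite prodf_seq_neq0 => /allP hs.
exists (u.[s] / v.[s] :: ts); last by rewrite /= ss hr.
rewrite /= us andbT; apply/negP => /hs /=.
by rewrite hornerD hornerN hornerM hornerC divfK // subrr eqxx.
Qed.

End Pigeonhole.

Lemma map_base_point (k : fieldType) (P : 'M[k]_2) (A B : comNzRingType) (iota : k -> A)
    (s : {rmorphism A -> B}) a c :
  map_mx s (base_point P iota a c) = base_point P (s \o iota) (s a) (s c).
Proof. by rewrite /base_point map_mxD !map_mxZ -!map_mx_comp. Qed.

Lemma eq_base_point (k : fieldType) (P : 'M[k]_2) (A : comNzRingType) (iota iota' : k -> A) a c :
  iota =1 iota' -> base_point P iota a c = base_point P iota' a c.
Proof. by move=> e; rewrite /base_point !(eq_map_mx _ e). Qed.

Section GenericPoint.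
Variables (k : fieldType) (n : nat) (P : 'M[k]_2) (D : datum k n.+1).
Hypothesis k_infinite : infinite_field k.
Hypothesis P_unit : P \in unitmx.
Hypothesis N0b0 : qf (N0 D) (b0 D) = 0.
Hypothesis moves : moving_base D != 0.
Hypothesis good_b2 : good_line D 1 (b2 D) != 0.
Variables (f g : {mpoly k[2 + n.+1]}) (dx dy : nat).
Hypothesis f_pencil : pencil_equation P D f.
Hypothesis bihom_g : bihomogeneous dx dy g.
Hypothesis g_image : vanishes_on_image P D g.

(* [R] carries a universal point: these hypotheses say that it is freely generated over [k] by
   the coordinates of [xi] and [eta]. *)
Variables (R : idomainType) (j : {rmorphism k -> R}) (xi : 'rV[R]_2) (eta : 'rV[R]_n.+1).
Hypothesis specialize :
  forall (B : comNzRingType) (iota : {rmorphism k -> B}) (x : 'rV[B]_2) (y : 'rV[B]_n.+1),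
  exists ev : {rmorphism R -> B},
    [/\ ev \o j =1 iota, map_mx ev xi = x & map_mx ev eta = y].
Hypothesis specialize_unique :
  forall (B : comNzRingType) (ev ev' : {rmorphism R -> B}),
    ev \o j =1 ev' \o j -> map_mx ev xi = map_mx ev' xi ->
    map_mx ev eta = map_mx ev' eta -> ev =1 ev'.

Local Notation "V ^C" := (map_mx polyC V).

Definition on_line (F : {mpoly k[2 + n.+1]}) : {poly R} :=
  mmap (polyC \o j) (row_mx (xi^C) (line eta (map_mx j (b0 D))) 0) F.

Lemma map_on_line (L : idomainType) (iota : {rmorphism k -> L}) (ev : {rmorphism R -> L}) F :
  ev \o j =1 iota ->
  map_poly ev (on_line F) =
  mmap (polyC \o iota)
    (row_mx ((map_mx ev xi)^C) (line (map_mx ev eta) (map_mx iota (b0 D))) 0) F.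
Proof.
move=> evj; rewrite /on_line rmorph_mmap; apply: eq_mmap => i /=.
  by rewrite map_polyC /= -evj.
have ex : map_mx (map_poly ev) xi^C = (map_mx ev xi)^C.
  by apply/rowP => l; rewrite !mxE map_polyC.
have el := map_line ev eta (map_mx j (b0 D)).
rewrite -map_mx_comp (eq_map_mx _ evj) in el.
by rewrite -ex -el -map_row_mx [RHS]mxE.
Qed.

Lemma base_point_polyC (L : comNzRingType) (iota : {rmorphism k -> L}) a c :
  (base_point P iota a c)^C = base_point P (polyC \o iota) a%:P c%:P.
Proof. exact: map_base_point. Qed.

(** At such points the quadric divides the remainder by [line_dvd], and has larger degree. *)
Lemma remainder_vanishes_good (M : fieldType) (iota : {rmorphism k -> M}) (s c : M)
    (w : 'rV[M]_n.+1) (ev : {rmorphism R -> M}) (h : {poly R}) r1 r0 N :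
  ev \o j =1 iota ->
  let DM := map_datum iota D in
  map_mx ev xi = c *: base_point P iota (curve_a DM 1 s) (curve_b DM 1 s) ->
  map_mx ev eta = w -> c != 0 -> good_line DM s w != 0 ->
  forall a, a ^+ N *: on_line g = h * on_line f + (r1%:P * 'X + r0%:P) ->
  ev r1 = 0 /\ ev r0 = 0.
Proof.
move=> evj DM exi eeta c0 gl a /(congr1 (map_poly ev)).
rewrite map_polyZ rmorphD rmorphM /= !(map_on_line _ evj) exi eeta.
have dv := line_dvd N0b0 moves bihom_g g_image gl.
have fe : mmap (polyC \o iota)
    (row_mx (c *: base_point P iota (curve_a DM 1 s) (curve_b DM 1 s))^C (line w (b0 DM)) 0) f =
    (c ^+ 3)%:P * qf (fibre DM 1 s)^C (line w (b0 DM)).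
  rewrite -base_pointZ base_point_polyC (f_pencil (polyC \o iota)) -map_datum_comp map_cubic_pencil.
  by rewrite cubic_pencilZ map_mxZ qfZM.
have ge : mmap (polyC \o iota)
    (row_mx (c *: base_point P iota (curve_a DM 1 s) (curve_b DM 1 s))^C (line w (b0 DM)) 0) g =
    (c ^+ dx)%:P * mmap (polyC \o iota)
     (row_mx (base_point P (polyC \o iota) (curve_a DM 1 s)%:P (curve_b DM 1 s)%:P)
             (line w (b0 DM)) 0) g.
  rewrite map_mxZ -base_point_polyC /= -[line w _ in LHS]scale1r.
  by rewrite (bihomogeneousZ (polyC \o iota) _ _ _ _ bihom_g) expr1n mulr1 -polyC_exp.
rewrite fe ge => E.
have a0 : qf (fibre DM 1 s) (b0 DM) != 0.
  by apply: contraNneq gl => z; rewrite /good_line z mulr0.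
have : qf (fibre DM 1 s)^C (line w (b0 DM)) %| map_poly ev (r1%:P * 'X + r0%:P).
  have d0 : qf (fibre DM 1 s)^C (line w (b0 DM)) %|
      map_poly ev h * ((c ^+ 3)%:P * qf (fibre DM 1 s)^C (line w (b0 DM))).
    by rewrite mulrA dvdp_mull.
  rewrite -(dvdp_addr _ d0).
  by rewrite -E -mul_polyC; do 2!apply: dvdp_mull.
have -> : map_poly ev (r1%:P * 'X + r0%:P) = (ev r1)%:P * 'X + (ev r0)%:P.
  by rewrite rmorphD rmorphM /= !map_polyC map_polyX.
move=> dr.
have sr : (size ((ev r1)%:P * 'X + (ev r0)%:P)%R <= 2)%N.
  by rewrite size_MXaddC; case: ifP => // _; rewrite ltnS size_polyC_leq1.
have r0' : (ev r1)%:P * 'X + (ev r0)%:P = 0.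
  apply/eqP/negPn/negP => nz; have := dvdp_leq nz dr.
  by rewrite size_line_qf // leqNgt ltnS sr.
have rl l := congr1 (fun q : {poly M} => q`_l) r0'.
by split; [have := rl 1%N | have := rl 0%N];
  rewrite coefD coefMX !coefC /= ?addr0 ?add0r.
Qed.

(** The nondegeneracy conditions are removed by joining [(s, w)] to [(1, b2)] by a line: the
conditions hold at [b2], hence at the generic point of the line, so the remainder vanishes on
the whole line. *)
Lemma remainder_vanishes (L : fieldType) (iota : {rmorphism k -> L}) (s c : L)
    (w : 'rV[L]_n.+1) (ev : {rmorphism R -> L}) (h : {poly R}) r1 r0 N a :
  ev \o j =1 iota ->
  let DL := map_datum iota D in
  map_mx ev xi = c *: base_point P iota (curve_a DL 1 s) (curve_b DL 1 s) ->
  map_mx ev eta = w -> c != 0 ->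
  a ^+ N *: on_line g = h * on_line f + (r1%:P * 'X + r0%:P) ->
  ev r1 = 0 /\ ev r0 = 0.
Proof.
move=> evj DL exi eeta c0 E.
pose iT : {rmorphism k -> {poly L}} := polyC \o iota.
pose sT : {poly L} := 1 + 'X * (s - 1)%:P.
pose wT : 'rV[{poly L}]_n.+1 := (b2 DL)^C + 'X *: (w - b2 DL)^C.
pose DT := map_datum iT D.
pose hev t : {rmorphism {poly L} -> L} := horner_eval t.
have eDT t : map_datum (hev t) DT = DL.
  rewrite /DT map_datum_comp; apply: eq_map_datum => x /=.
  by rewrite /hev /= /horner_eval hornerC.
have es t : hev t sT = 1 + t * (s - 1).
  by rewrite /hev /= /horner_eval /sT !hornerE.
have ew t : map_mx (hev t) wT = b2 DL + t *: (w - b2 DL).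
  by apply/rowP=> i; rewrite !mxE /hev /= /horner_eval !hornerE.
have [evT [evTj eTxi eTeta]] :=
  specialize iT (c%:P *: base_point P iT (curve_a DT 1 sT) (curve_b DT 1 sT)) wT.
pose tau : {rmorphism {poly L} -> {fraction {poly L}}} := @FracField.tofrac {poly L}.
pose evM : {rmorphism R -> {fraction {poly L}}} := tau \o evT.
pose iM : {rmorphism k -> {fraction {poly L}}} := tau \o iT.
have tau_inj : injective tau by move=> x y /eqP; rewrite tofrac_eq => /eqP.
have eDM : map_datum iM D = map_datum tau DT by rewrite /DT map_datum_comp.
have eMj : evM \o j =1 iM by move=> x; exact: (congr1 tau (evTj x)).
have eMxi : map_mx evM xi = tau c%:P *: base_point P iM (curve_a (map_datum iM D) 1 (tau sT))
    (curve_b (map_datum iM D) 1 (tau sT)).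
  rewrite map_mx_comp eTxi map_mxZ map_base_point eDM -(rmorph1 tau) map_curve_a map_curve_b.
  by [].
have eMeta : map_mx evM eta = map_mx tau wT by rewrite map_mx_comp eTeta.
have c0M : tau c%:P != 0 by rewrite -(rmorph0 tau) (inj_eq tau_inj) polyC_eq0.
have glM : good_line (map_datum iM D) (tau sT) (map_mx tau wT) != 0.
  rewrite eDM map_good_line -(rmorph0 tau) (inj_eq tau_inj).
  apply: contraNneq good_b2 => z; rewrite -(fmorph_eq0 iota) -map_good_line rmorph1.
  have := congr1 (hev 0) z; rewrite -map_good_line eDT es ew mul0r addr0.
  by rewrite scale0r addr0 rmorph0 => ->.
have [z1 z0] := remainder_vanishes_good eMj eMxi eMeta c0M glM E.
have evE : ev =1 hev 1 \o evT.
  apply: specialize_unique => [x /=| |].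
  - by rewrite [LHS]evj (evTj x : evT (j x) = _) /hev /= /horner_eval hornerC.
  - rewrite [RHS]map_mx_comp eTxi exi map_mxZ map_base_point.
    rewrite -!map_curve_a -!map_curve_b eDT es rmorph1 mul1r addrCA subrr addr0.
    rewrite (@eq_base_point _ _ _ (hev 1 \o iT) iota).
      by congr (_ *: _); rewrite /hev /= /horner_eval hornerC.
    by move=> x; rewrite /hev /= /horner_eval hornerC.
  - by rewrite [RHS]map_mx_comp eTeta ew scale1r addrCA subrr addr0.
by rewrite !evE /=; move: z1 z0; rewrite /= -!(rmorph0 tau) => /tau_inj -> /tau_inj ->;
  rewrite rmorph0.
Qed.

Lemma base_pointE (A : comNzRingType) (iota : {rmorphism k -> A}) (u : 'rV[A]_2) :
  base_point P iota (u 0 0) (u 0 1) = u *m map_mx iota P.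
Proof.
rewrite mulmx_sum_row !big_ord_recl big_ord0 addr0 /base_point -!map_row.
by congr (_ *: _ + u 0 _ *: map_mx iota (row _ P)); apply: val_inj.
Qed.

Definition coords (A : comNzRingType) (iota : {rmorphism k -> A}) (x : 'rV[A]_2) :=
  x *m map_mx iota (invmx P).

Lemma coordsK (A : comNzRingType) (iota : {rmorphism k -> A}) (x : 'rV[A]_2) :
  base_point P iota (coords iota x 0 0) (coords iota x 0 1) = x.
Proof. by rewrite base_pointE -mulmxA -map_mxM mulVmx // map_mx1 mulmx1. Qed.

Lemma coords_base_point (A : comNzRingType) (iota : {rmorphism k -> A}) a c :
  coords iota (base_point P iota a c) = \row_i (if i == 0 then a else c).
Proof.
set u : 'rV[A]_2 := \row_i _.
have -> : base_point P iota a c = base_point P iota (u 0 0) (u 0 1) by rewrite !mxE.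
by rewrite base_pointE /coords -mulmxA -map_mxM mulmxV // map_mx1 mulmx1.
Qed.

Lemma map_coords (A B : comNzRingType) (iota : {rmorphism k -> A}) (s : {rmorphism A -> B})
    (iota' : {rmorphism k -> B}) x :
  s \o iota =1 iota' -> map_mx s (coords iota x) = coords iota' (map_mx s x).
Proof. by move=> e; rewrite /coords map_mxM -map_mx_comp (eq_map_mx _ e). Qed.

(** On the affine cone over [P^1], the points proportional to some [x(s)] with [s] in [k] lie on
infinitely many lines through the origin; so a function vanishing at all of them is zero. *)
Lemma vanishing_is_zero (r : R) :
  (forall (L : fieldType) (iota : {rmorphism k -> L}) (s c : L) (w : 'rV[L]_n.+1)
     (ev : {rmorphism R -> L}), ev \o j =1 iota ->
     let DL := map_datum iota D in
     map_mx ev xi = c *: base_point P iota (curve_a DL 1 s) (curve_b DL 1 s) ->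
     map_mx ev eta = w -> c != 0 -> ev r = 0) -> r = 0.
Proof.
move=> hr.
pose L : fieldType := {fraction R}.
pose tau : {rmorphism R -> L} := @FracField.tofrac R.
have tau_inj : injective tau by move=> x y /eqP; rewrite tofrac_eq => /eqP.
pose io : {rmorphism k -> L} := tau \o j.
pose al := coords j xi 0 0; pose be := coords j xi 0 1.
have be0 : be != 0.
  have [ev [evj exi _]] := specialize idfun (base_point P idfun 0 1) (0 : 'rV[k]_n.+1).
  apply/eqP => z; have := congr1 (fun M : 'rV[k]_2 => M 0 1) (map_coords xi evj).
  rewrite exi coords_base_point [LHS]mxE [RHS]mxE -/be z rmorph0 => /eqP.
  by rewrite eq_sym oner_eq0.
pose iT : {rmorphism k -> {poly L}} := polyC \o io.
have [evT [evTj eTxi eTeta]] :=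
  specialize iT (base_point P iT ('X * (tau be)%:P) (tau be)%:P) (map_mx tau eta)^C.
pose hev t : {rmorphism {poly L} -> L} := horner_eval t.
have at_t t : [/\ hev t \o evT \o j =1 io,
   map_mx (hev t \o evT) xi = base_point P io (t * tau be) (tau be) &
   map_mx (hev t \o evT) eta = map_mx tau eta].
  split.
  - by move=> x /=; rewrite (evTj x : evT (j x) = _) /hev /= /horner_eval hornerC.
  - rewrite map_mx_comp eTxi map_base_point (@eq_base_point _ _ _ _ io).
      by rewrite /hev /= /horner_eval !hornerE.
    by move=> x; rewrite /hev /= /horner_eval hornerC.
  - by rewrite map_mx_comp eTeta; apply/rowP => i; rewrite !mxE /hev /= /horner_eval hornerC.
pose DX := map_datum (@polyC k) D.
pose u := curve_a DX 1 'X; pose v := curve_b DX 1 'X.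
pose hek s : {rmorphism {poly k} -> k} := horner_eval s.
have eDX s : map_datum (hek s) DX = D.
  rewrite /DX map_datum_comp -[RHS]map_datum_id; apply: eq_map_datum => x /=.
  by rewrite /hek /= /horner_eval hornerC.
have us s : u.[s] = curve_a D 1 s.
  by rewrite -[u.[s]]/(hek s u) -map_curve_a eDX rmorph1 /hek /= /horner_eval hornerX.
have vs s : v.[s] = curve_b D 1 s.
  by rewrite -[v.[s]]/(hek s v) -map_curve_b eDX rmorph1 /hek /= /horner_eval hornerX.
have rho0 : evT r = 0.
  apply: (@ratio_pigeonhole k k_infinite L io u v); first by rewrite !us !vs.
  move=> s v0; have [e1 e2 e3] := at_t (io (u.[s] / v.[s])).
  apply/eqP.
  apply: (hr L io (io s) (tau be / io v.[s]) _ (hev _ \o evT) e1 _ e3).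
    rewrite e2 -base_pointZ -!(rmorph1 io) map_curve_a map_curve_b -us -vs fmorph_div.
    rewrite [in RHS]divfK ?fmorph_eq0 // mulrAC [X in base_point _ _ (X / _)]mulrC.
    by rewrite [in RHS]mulrAC.
  by rewrite mulf_neq0 ?invr_eq0 ?fmorph_eq0 // -(rmorph0 tau) (inj_eq tau_inj).
have [e1 e2 e3] := at_t (tau al / tau be).
apply: (tau_inj); rewrite rmorph0.
have -> : tau r = (hev (tau al / tau be) \o evT) r.
  apply: specialize_unique => [x||].
  - by rewrite [RHS]e1.
  - rewrite [RHS]e2 divfK; last by rewrite -(rmorph0 tau) (inj_eq tau_inj).
    rewrite -{1}(coordsK j xi) -/al -/be.
    by rewrite map_base_point.
  - by rewrite [RHS]e3.
by rewrite /= rho0 rmorph0.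
Qed.

(** Both coefficients of the pseudo-remainder vanish; the leading coefficient of [f] on the line
is its value at [b0], and does not involve [eta]. *)
Lemma generic_divisibility : exists N h,
  mmap j (row_mx xi (map_mx j (b0 D)) 0) f ^+ N * mmap j (row_mx xi eta 0) g =
  h * mmap j (row_mx xi eta 0) f.
Proof.
pose al := coords j xi 0 0; pose be := coords j xi 0 1.
pose DR := map_datum j D.
have exi : xi = base_point P j al be by rewrite coordsK.
have ef : on_line f = qf (cubic_pencil DR al be)^C (line eta (b0 DR)).
  rewrite /on_line {1}exi base_point_polyC (f_pencil (polyC \o j)) -map_datum_comp.
  by rewrite map_cubic_pencil.
have ea : mmap j (row_mx xi (map_mx j (b0 D)) 0) f = qf (cubic_pencil DR al be) (b0 DR).
  by rewrite {1}exi f_pencil.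
have a0 : qf (cubic_pencil DR al be) (b0 DR) != 0.
  rewrite -ea; have [ev [evj ex _]] :=
    specialize idfun (base_point P idfun (curve_a D 1 1) (curve_b D 1 1)) (0 : 'rV[k]_n.+1).
  apply: contraNneq good_b2 => /(congr1 ev); rewrite rmorph_mmap rmorph0.
  pose h' := row_mx (base_point P idfun (curve_a D 1 1) (curve_b D 1 1)) (b0 D) 0.
  rewrite (eq_mmap (iota' := idfun) (h' := h') _ evj).
    rewrite /h' f_pencil map_datum_id => z.
    by rewrite /good_line /fibre z mulr0.
  have eb : map_mx ev (map_mx j (b0 D)) = b0 D.
    by rewrite -map_mx_comp (eq_map_mx _ evj) map_mx_id.
  by move=> i; rewrite /h' -ex -[in RHS]eb -map_row_mx [RHS]mxE.
have [N [h [r1 [r0 E]]]] := pseudo_division (on_line g) (size_line_qf eta a0).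
rewrite -ef in E.
have z1 : r1 = 0.
  apply: vanishing_is_zero => L io s c w ev h1 h2 h3 h4 h5.
  by case: (remainder_vanishes h1 h3 h4 h5 E).
have z0 : r0 = 0.
  apply: vanishing_is_zero => L io s c w ev h1 h2 h3 h4 h5.
  by case: (remainder_vanishes h1 h3 h4 h5 E).
exists N, h.[0].
have at0 F : (on_line F).[0] = mmap j (row_mx xi eta 0) F.
  rewrite -[LHS]/(horner_eval 0 (on_line F)) rmorph_mmap; apply: eq_mmap => i /=.
    by rewrite /horner_eval hornerC.
  transitivity (map_mx (horner_eval 0) (row_mx xi^C (line eta (map_mx j (b0 D)))) 0 i).
    by rewrite [RHS]mxE.
  rewrite map_row_mx; congr (row_mx _ _ 0 i); apply/rowP=> l;
    by rewrite !mxE /horner_eval !hornerE.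
have := congr1 (horner_eval 0) E; rewrite z1 z0 mul0r addr0 addr0 /horner_eval.
by rewrite hornerZ hornerM !at0 ef lead_line_qf // ea.
Qed.

End GenericPoint.

(** * Cancellation of the content *)

(** Cancelling the powers of the outer indeterminate from [C] is possible because it does not
divide [F]. *)
Lemma cancel_content (K : idomainType) (C : {poly K}) (F G H : {poly {poly K}}) :
  C != 0 -> map_poly polyC C * G = H * F -> F.[0] != 0 -> F.[0].[0] = 0 ->
  G.[0].[0] = 0.
Proof.
move=> C0 E F0 F00.
elim: (size C) {-2}C (leqnn (size C)) C0 H E => [|d IH] {}C sC C0 H E.
  by rewrite leqn0 size_poly_eq0 (negbTE C0) in sC.
have [C00|C00] := eqVneq C.[0] 0; last first.
  have := congr1 (fun q : {poly {poly K}} => q.[0].[0]) E.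
  rewrite /= !hornerM F00 mulr0 -(rmorph0 polyC) horner_map /= hornerC => /eqP.
  by rewrite rmorph0 mulf_eq0 (negbTE C00) => /eqP.
have [C' eC] : exists C', C = C' * 'X.
  have /factor_theorem[C'] : root C 0 by apply/eqP.
  by rewrite subr0 => ->; exists C'.
have [H' eH] : exists H', H = H' * 'X.
  have /factor_theorem[H'] : root H 0.
    have := congr1 (fun q : {poly {poly K}} => q.[0]) E.
    rewrite /= !hornerM -(rmorph0 polyC) horner_map /= C00 rmorph0 mul0r => /esym/eqP.
    by rewrite mulf_eq0 (negbTE F0) orbF.
  by rewrite subr0 => ->; exists H'.
have C'0 : C' != 0 by apply: contraNneq C0 => z; rewrite eC z mul0r.
apply: (IH C' _ C'0 H').
  by move: sC; rewrite eC size_mulX.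
apply: (mulIf (negbT (polyX_eq0 _))).
have -> : map_poly polyC C' * G * 'X = map_poly polyC C * G.
  by rewrite eC rmorphM /= map_polyX; ring.
by rewrite E eH; ring.
Qed.

Section Cubes.
Variables (k : fieldType) (m : nat) (D : datum k m).

Definition test_point (j : 'I_4) : 'rV[k]_m :=
  nth 0 [:: b0 D; b3 D; b1 D; b0 D + b1 D] j.

(** Since [N0, ..., N3] are independent, every binary cubic form is a combination of values of
the pencil at fixed vectors. *)
Lemma cubes_from_values : \det (value_matrix D) != 0 ->
  exists u v : 'I_4 -> k, forall (A : comNzRingType) (iota : {rmorphism k -> A}) (a c : A),
    let F j := qf (cubic_pencil (map_datum iota D) a c) (map_mx iota (test_point j)) in
    a ^+ 3 = \sum_j F j * iota (u j) /\ c ^+ 3 = \sum_j F j * iota (v j).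
Proof.
move=> d0; have gU : value_matrix D \in unitmx by rewrite unitmxE unitfE.
pose V := invmx (value_matrix D).
exists (fun j => V j 0), (fun j => V j 3%:R) => A iota a c F.
pose r : 'rV[A]_4 := \row_i (nth 0 [:: a ^+ 3; a ^+ 2 * c; a * c ^+ 2; c ^+ 3] i).
have eF : r *m map_mx iota (value_matrix D) = \row_j F j.
  apply/rowP=> j; rewrite !mxE /F cubic_pencil_qf /=.
  rewrite !big_ord_recl big_ord0 /= !mxE /= -!map_qf /test_point; ring.
have er : r = (\row_j F j) *m map_mx iota (invmx (value_matrix D)).
  by rewrite -eF -mulmxA -map_mxM mulmxV // map_mx1 mulmx1.
have := congr1 (fun M : 'rV[A]_4 => M 0 0) er.
have := congr1 (fun M : 'rV[A]_4 => M 0 3%:R) er.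
rewrite !mxE /= => -> ->.
by split; apply: eq_bigr => j _; rewrite !mxE.
Qed.

End Cubes.

Section GenericCoordinates.
Variables (k : fieldType) (n : nat).
Local Notation R := {mpoly k[2 + n.+1]}.

Definition generic_x : 'rV[R]_2 := \row_i 'X_(lshift n.+1 i).
Definition generic_y : 'rV[R]_n.+1 := \row_j 'X_(rshift 2 j).

Lemma row_mx_gen i : row_mx generic_x generic_y 0 i = 'X_i.
Proof.
by rewrite -[i]splitK /unsplit; case: split => l; rewrite ?row_mxEl ?row_mxEr mxE.
Qed.

Lemma mmap_gen (p : R) : mmap (@mpolyC _ k) (row_mx generic_x generic_y 0) p = p.
Proof. by rewrite -[RHS]mmap_vars; apply: eq_mmap => // i; rewrite row_mx_gen. Qed.

Lemma gen_specialize (B : comNzRingType) (iota : {rmorphism k -> B})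
    (x : 'rV[B]_2) (y : 'rV[B]_n.+1) :
  exists ev : {rmorphism R -> B},
    [/\ ev \o @mpolyC _ k =1 iota, map_mx ev generic_x = x & map_mx ev generic_y = y].
Proof.
exists (mmap iota (row_mx x y 0)); split.
- by move=> c; rewrite /= mmapC.
- by apply/rowP=> i; rewrite !mxE /= mmapX mmap1U row_mxEl.
- by apply/rowP=> i; rewrite !mxE /= mmapX mmap1U row_mxEr.
Qed.

Lemma gen_specialize_unique (B : comNzRingType) (ev ev' : {rmorphism R -> B}) :
  ev \o @mpolyC _ k =1 ev' \o @mpolyC _ k -> map_mx ev generic_x = map_mx ev' generic_x ->
  map_mx ev generic_y = map_mx ev' generic_y -> ev =1 ev'.
Proof.
move=> e1 e2 e3 p; rewrite -(mmap_gen p) !rmorph_mmap; apply: eq_mmap => // i /=.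
have e : map_mx ev (row_mx generic_x generic_y) = map_mx ev' (row_mx generic_x generic_y).
  by rewrite !map_row_mx e2 e3.
have := congr1 (fun M : 'rV[B]_(2 + n.+1) => M 0 i) e.
by rewrite [LHS]mxE [RHS]mxE.
Qed.

End GenericCoordinates.

Section ZerosSubset.
Variables (k : fieldType) (n : nat) (P : 'M[k]_2) (D : datum k n.+1).
Hypothesis k_infinite : infinite_field k.
Hypothesis P_unit : P \in unitmx.
Hypothesis N0b0 : qf (N0 D) (b0 D) = 0.
Hypothesis moves : moving_base D != 0.
Hypothesis good_b2 : good_line D 1 (b2 D) != 0.
Hypothesis indep : \det (value_matrix D) != 0.
Variables (f g : {mpoly k[2 + n.+1]}) (dx dy : nat).
Hypothesis f_pencil : pencil_equation P D f.
Hypothesis bihom_g : bihomogeneous dx dy g.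
Hypothesis g_image : vanishes_on_image P D g.

Lemma base_point00 (A : comNzRingType) (iota : k -> A) : base_point P iota 0 0 = 0.
Proof. by rewrite /base_point !scale0r addr0. Qed.

(** If all values vanished, so would the cubes of both coordinates on [P^1]. *)
Lemma fibre_neq0 (K : fieldType) (iota : {rmorphism k -> K}) (a c : K) :
  base_point P iota a c != 0 ->
  exists w, qf (cubic_pencil (map_datum iota D) a c) w != 0.
Proof.
move=> ac0; have [u [v uv]] := cubes_from_values indep.
have [/= ea ec] := uv K iota a c.
case: (pickP (fun j : 'I_4 =>
   qf (cubic_pencil (map_datum iota D) a c) (map_mx iota (test_point D j)) != 0)).
  by move=> l hl; exists (map_mx iota (test_point D l)).
move=> z; case/negP: ac0; apply/eqP.
have a0 : a = 0.
  apply/eqP; rewrite -[_ == 0](@expf_eq0 _ a 3) ea big1 // => l _.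
  by move/negbFE/eqP: (z l) => ->; rewrite mul0r.
have c0 : c = 0.
  apply/eqP; rewrite -[_ == 0](@expf_eq0 _ c 3) ec big1 // => l _.
  by move/negbFE/eqP: (z l) => ->; rewrite mul0r.
by rewrite a0 c0 base_point00.
Qed.

(** The given zero is put on a family with two parameters, one moving [x] and one moving [y];
the first makes the factor depending on [x] nonzero, the second makes the restriction of [f] to
the special fibre nonzero. *)
Lemma zeros_subset_of_image : zeros_subset f g.
Proof.
move=> K iota x y x0 _ fxy.
have [N [h E]] := generic_divisibility k_infinite P_unit N0b0 moves good_b2
  f_pencil bihom_g g_image (@gen_specialize k n) (@gen_specialize_unique k n).
pose B : comNzRingType := {poly K}.
pose A : comNzRingType := {poly {poly K}}.
pose a := coords P iota x 0 0; pose c := coords P iota x 0 1.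
have ex : x = base_point P iota a c by rewrite coordsK.
have [w w0] : exists w, qf (cubic_pencil (map_datum iota D) a c) w != 0.
  by apply: fibre_neq0; rewrite -ex.
pose DK := map_datum iota D.
(* A line joining [x] to a parameter at which the fibre does not contain [b0], so that the
   factor to be cancelled is a nonzero polynomial in the parameter of the line. *)
pose a1 : {poly K} := a%:P + 'X * (curve_a DK 1 1 - a)%:P.
pose c1 : {poly K} := c%:P + 'X * (curve_b DK 1 1 - c)%:P.
pose jB : {rmorphism k -> {poly K}} := polyC \o iota.
pose up : {rmorphism {poly K} -> {poly {poly K}}} := map_poly polyC.
pose jA : {rmorphism k -> {poly {poly K}}} := up \o jB.
pose yA : 'rV[{poly {poly K}}]_n.+1 := map_mx polyC (line y w).
have [ev [evj evx evy]] := gen_specialize jA (base_point P jA (up a1) (up c1)) yA.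
pose hB t : {rmorphism {poly K} -> K} := horner_eval t.
pose hA : {rmorphism {poly {poly K}} -> {poly K}} := horner_eval 0.
have hAj : hA \o jA =1 polyC \o iota.
  by move=> z; rewrite /hA /jA /up /= /horner_eval map_polyC hornerC.
have hAup q : hA (up q) = (q.[0])%:P.
  by rewrite /hA /up /= /horner_eval -(rmorph0 polyC) horner_map.
have evpt : map_mx ev (row_mx (generic_x k n) (generic_y k n)) =
    row_mx (base_point P jA (up a1) (up c1)) yA.
  by rewrite map_row_mx evx evy.
have evE F : ev (mmap (@mpolyC _ k) (row_mx (generic_x k n) (generic_y k n) 0) F) =
    mmap jA (row_mx (base_point P jA (up a1) (up c1)) yA 0) F.
  rewrite rmorph_mmap; apply: eq_mmap => // i; rewrite /= -evpt.
  by rewrite [RHS]mxE.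
have atF : (mmap jA (row_mx (base_point P jA (up a1) (up c1)) yA 0) f).[0] =
    qf (map_mx polyC (cubic_pencil DK a c)) (line y w).
  rewrite -[LHS]/(hA _) rmorph_mmap.
  rewrite (@eq_mmap _ _ _ _ jB _ (row_mx (base_point P jB a%:P c%:P) (line y w) 0) _ hAj).
    by rewrite f_pencil /jB -map_datum_comp -map_cubic_pencil.
  move=> i; transitivity (map_mx hA (row_mx (base_point P jA (up a1) (up c1)) yA) 0 i).
    by rewrite [RHS]mxE.
  rewrite map_row_mx map_base_point (eq_base_point _ _ _ hAj) !hAup.
  have -> : map_mx hA yA = line y w.
    by apply/rowP=> l; rewrite !mxE /hA /= /horner_eval hornerC.
  by rewrite /a1 /c1 !hornerE.
have at00 F : (mmap jA (row_mx (base_point P jA (up a1) (up c1)) yA 0) F).[0].[0] =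
    mmap iota (row_mx x y 0) F.
  rewrite -[LHS]/(hB 0 (hA _)) !rmorph_mmap; apply: eq_mmap => [z|i].
    by have /= := hAj z; rewrite /= => ->; rewrite /hB /= /horner_eval hornerC.
  transitivity (map_mx (hB 0) (map_mx hA (row_mx (base_point P jA (up a1) (up c1)) yA)) 0 i).
    by rewrite [RHS]mxE [in RHS]mxE.
  rewrite !map_row_mx !map_base_point !hAup.
  have -> : map_mx (hB 0) (map_mx hA yA) = y.
    by apply/rowP=> l; rewrite !mxE /hA /hB /= /horner_eval !hornerE.
  rewrite (@eq_base_point _ _ _ _ iota).
    by rewrite /hB /= /horner_eval /a1 /c1 !hornerE -ex.
  by move=> z /=; have /= -> := hAj z; rewrite /hB /= /horner_eval hornerC.
pose C := qf (cubic_pencil (map_datum jB D) a1 c1) (b0 (map_datum jB D)).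
have C0 : C != 0.
  apply: contraNneq good_b2 => /(congr1 (hB 1)).
  have hj : hB 1 \o jB =1 iota by move=> z; rewrite /hB /= /horner_eval hornerC.
  rewrite -map_qf -map_cubic_pencil map_datum_comp (eq_map_datum _ hj) -map_mx_comp.
  rewrite (eq_map_mx _ hj) rmorph0.
  have -> : hB 1 a1 = curve_a DK 1 1.
    rewrite /hB /= /horner_eval /a1 hornerD hornerM !hornerC hornerX mul1r.
    by rewrite addrC subrK.
  have -> : hB 1 c1 = curve_b DK 1 1.
    rewrite /hB /= /horner_eval /c1 hornerD hornerM !hornerC hornerX mul1r.
    by rewrite addrC subrK.
  move=> z; rewrite -(fmorph_eq0 iota) -map_good_line rmorph1 /good_line.
  by rewrite /fibre z mulr0.
have evC :
    ev (mmap (@mpolyC _ k) (row_mx (generic_x k n) (map_mx (@mpolyC _ k) (b0 D)) 0) f) = up C.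
  rewrite rmorph_mmap.
  rewrite (@eq_mmap _ _ _ _ jA _
            (row_mx (base_point P jA (up a1) (up c1)) (map_mx jA (b0 D)) 0)) //.
    by rewrite f_pencil /C -map_qf -map_cubic_pencil map_datum_comp -map_mx_comp.
  move=> i; rewrite /= -evx -(eq_map_mx _ evj) map_mx_comp -map_row_mx.
  by rewrite [RHS]mxE.
have := congr1 ev E; rewrite !rmorphM rmorphXn evC !evE -rmorphXn => E'.
rewrite /vanishes_at -at00; apply: (cancel_content _ E'); last by rewrite at00.
  by rewrite expf_eq0 (negbTE C0) andbF.
rewrite atF; apply/eqP => z.
by have := size_line_qf y w0; rewrite z size_poly0.
Qed.

End ZerosSubset.

(** * Irreducibility *)

Section DegreeInY.
Variables (k : fieldType) (n : nat).
Implicit Types (f g h : {mpoly k[2 + n.+1]}).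

Definition yweight (i : 'I_(2 + n.+1)) : nat := if split i is inr _ then 1 else 0.

Lemma wdeg_yweight (m : 'X_{1..2 + n.+1}) : wdeg yweight m = ydeg m.
Proof.
rewrite /wdeg big_split_ord /= big1 ?add0n => [|i _]; last first.
  by rewrite /yweight (unsplitK (inl i)).
by apply: eq_bigr => i _; rewrite /yweight (unsplitK (inr i)) mul1n.
Qed.

Lemma ydeg_factors f g h d e : bihomogeneous d e f -> f != 0 -> f = g * h ->
  exists i j, [/\ (i + j = e)%N, {in msupp g, forall m, ydeg m = i} &
                  {in msupp h, forall m, ydeg m = j}].
Proof.
move=> hf f0 efgh.
have sf : wscale yweight f = f%:P * 'X^e.
  rewrite wscaleE [f in RHS]mpolyE rmorph_sum mulr_suml.
  by apply: eq_big_seq => m /hf[_]; rewrite wdeg_yweight => <-.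
rewrite efgh in f0 sf.
have [i [j [eij gi hj]]] := wscale_factor f0 sf.
exists i, j; split=> // m mg; rewrite -wdeg_yweight.
  exact: (wscale_homog gi).
exact: (wscale_homog hj).
Qed.

Lemma ydeg0_eval (A : comNzRingType) (iota : {rmorphism k -> A}) g (x : 'rV[A]_2)
    (y z : 'rV[A]_n.+1) : {in msupp g, forall m, ydeg m = 0%N} ->
  mmap iota (row_mx x y 0) g = mmap iota (row_mx x z 0) g.
Proof.
move=> hg; apply: eq_big_seq => m /hg /eqP; rewrite sum_nat_eq0 => /forallP m0.
rewrite !mmap1_row; congr (_ * (_ * _)).
by rewrite !big1 // => j _; rewrite (eqP (m0 j)) expr0.
Qed.

Lemma ydeg1_linear (A : comNzRingType) (iota : {rmorphism k -> A}) g (x : 'rV[A]_2)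
    a (y z : 'rV[A]_n.+1) : {in msupp g, forall m, ydeg m = 1%N} ->
  mmap iota (row_mx x (a *: y + z) 0) g =
  a * mmap iota (row_mx x y 0) g + mmap iota (row_mx x z 0) g.
Proof.
move=> hg; rewrite /mmap mulr_sumr -big_split; apply: eq_big_seq => m /hg /sum_eq1[l ml].
rewrite !mmap1_row.
have lin (u : 'rV[A]_n.+1) : \prod_(j < n.+1) u 0 j ^+ m (rshift 2 j) = u 0 l.
  by under eq_bigr => j _ do rewrite ml; rewrite prod_exp1.
by rewrite !lin !mxE /=; ring.
Qed.

End DegreeInY.

(** For a union of two hyperplanes, the tangent hyperplane at a point of one of them is this
hyperplane, hence contained in the quadric. *)
Lemma product_of_linear_forms (k : fieldType) m (M : 'M[k]_m) (l1 l2 : 'rV[k]_m -> k)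
    (y w e : 'rV[k]_m) :
  (forall a u v, l1 (a *: u + v) = a * l1 u + l1 v) ->
  (forall a u v, l2 (a *: u + v) = a * l2 u + l2 v) ->
  (forall u, qf M u = l1 u * l2 u) -> l1 y = 0 -> resultant_at M y w e = 0.
Proof.
move=> lin1 lin2 hM y0.
have bfy u : bf M y u = l1 u * l2 y.
  have E := qfD M y u; rewrite !hM y0 -[y in l1 (y + u)]scale1r -[y in l2 (y + u)]scale1r in E.
  rewrite lin1 lin2 y0 in E; apply: (addrI (0 * l2 y)); apply: (addIr (l1 u * l2 u)).
  by rewrite -E; ring.
have l10 : l1 0 = 0.
  have := lin1 (-1) 0 0; rewrite scaler0 addr0 mulN1r addNr; exact.
rewrite /resultant_at hM lin1 -[_ *: e]addr0 lin1 l10 !bfy; ring.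
Qed.

Section Irreducible.
Variables (k : fieldType) (n : nat) (P : 'M[k]_2) (D : datum k n.+1).
Hypothesis P_unit : P \in unitmx.
Hypothesis N0b0 : qf (N0 D) (b0 D) = 0.
Hypothesis moves : moving_base D != 0.
Hypothesis good_b2 : good_line D 1 (b2 D) != 0.
Hypothesis indep : \det (value_matrix D) != 0.
Variables (f : {mpoly k[2 + n.+1]}).
Hypothesis bihom_f : bihomogeneous 3 2 f.
Hypothesis f_pencil : pencil_equation P D f.

Lemma fibre_eval y :
  mmap idfun (row_mx (base_point P idfun (curve_a D 1 1) (curve_b D 1 1)) y 0) f =
  qf (fibre D 1 1) y.
Proof. by rewrite f_pencil map_datum_id. Qed.

Lemma bihom_neq0 : f != 0.
Proof.
apply: contraNneq good_b2 => z.
by rewrite /good_line -fibre_eval z raddf0 mulr0.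
Qed.

(** A factor of degree 0 in [y] divides all the values of [f] at fixed [y], hence the cubes of
the coordinates on [P^1] and the fifth powers of the two variables [x_i]. Its leading monomial
then divides powers of two different variables. *)
Lemma ydeg0_factor_unit g h : f = g * h -> {in msupp g, forall m, ydeg m = 0%N} ->
  g \is a GRing.unit.
Proof.
move=> efgh g0.
have gn0 : g != 0 by apply: contraNneq bihom_neq0 => z; rewrite efgh z mul0r.
pose j : {rmorphism k -> {mpoly k[2 + n.+1]}} := @mpolyC _ k.
pose xi := generic_x k n.
pose al := coords P j xi 0 0; pose be := coords P j xi 0 1.
have exi : xi = base_point P j al be by rewrite coordsK.
have val (w : 'rV_n.+1) : qf (cubic_pencil (map_datum j D) al be) w =
    g * mmap j (row_mx xi w 0) h.
  rewrite -f_pencil -exi efgh rmorphM; congr (_ * _).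
  exact: etrans (ydeg0_eval j xi w (generic_y k n) g0) (mmap_gen _).
have [u [v /(_ _ j al be) /= [ea eb]]] := cubes_from_values indep.
have [a' ea'] : exists a', al ^+ 3 = g * a'.
  rewrite ea; eexists; under eq_bigr => l _ do rewrite val -mulrA.
  by rewrite -mulr_sumr; reflexivity.
have [b' eb'] : exists b', be ^+ 3 = g * b'.
  rewrite eb; eexists; under eq_bigr => l _ do rewrite val -mulrA.
  by rewrite -mulr_sumr; reflexivity.
have pow i : exists c, ('X_(lshift n.+1 i) : {mpoly k[2 + n.+1]}) ^+ 5 = g * c.
  have -> : 'X_(lshift n.+1 i) = j (P 0 i) * al + j (P 1 i) * be.
    transitivity (xi 0 i); first by rewrite mxE.
    by rewrite exi /base_point !mxE mulrC [be * _]mulrC.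
  set s := j _; set t := j _.
  (* Every term of the binomial expansion of the fifth power contains a cube. *)
  pose X := s * al; pose Y := t * be.
  exists (a' * (s ^+ 3 * (X ^+ 2 + 5%:R * (X * Y) + 10%:R * Y ^+ 2))
    + b' * (t ^+ 3 * (10%:R * X ^+ 2 + 5%:R * (X * Y) + Y ^+ 2))).
  rewrite mulrDr !mulrA -ea' -eb' /X /Y; ring.
have lead i l : l != lshift n.+1 i -> mlead g l = 0%N.
  move=> li; have [c ec] := pow i.
  have c0 : c != 0.
    apply/eqP => z; move/eqP: ec; rewrite z mulr0 expf_eq0 /=.
    move=> /eqP/(congr1 (mcoeff U_(lshift n.+1 i))).
    by rewrite mcoeffX eqxx mcoeff0 => /eqP; rewrite oner_eq0.
  have := congr1 (fun p => mlead p l) ec; rewrite /= (mleadM gn0 c0) mnmDE.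
  rewrite mpolyXn mleadXm mulmnE mnmE eq_sym (negbTE li) mul0n => /esym/eqP.
  by rewrite addn_eq0 => /andP[/eqP].
have m0 : mlead g = 0%MM.
  apply/mnmP => l; rewrite mnm0E.
  have [-> | ne] := eqVneq l (lshift n.+1 0); last exact: lead ne.
  by apply: (lead 1); rewrite (inj_eq (@lshift_inj _ _)).
have sg : (msize g <= 1)%N by rewrite -mlead_deg // m0 mdeg0.
rewrite (msize1_polyC sg); apply: rmorph_unit; rewrite unitfE.
by apply: contraNneq gn0 => z; rewrite (msize1_polyC sg) z mpolyC0.
Qed.

Lemma irreducible_of_good : irreducible_mpoly f.
Proof.
split; first exact: bihom_neq0.
  apply/negP => /andP[/eqP ef _].
  have : qf (fibre D 1 1) 0 = f@_0 by rewrite -fibre_eval {1}ef mmapC.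
  rewrite qf0 => z; move: bihom_neq0; rewrite ef -z mpolyC0 eqxx; exact: id.
move=> g h efgh.
have [i [j [eij gi hj]]] := ydeg_factors bihom_f bihom_neq0 efgh.
case: i eij gi => [|[|i]] eij gi.
- by left; apply: (ydeg0_factor_unit efgh gi).
- have j1 : j = 1%N by case: eij.
  rewrite j1 in hj.
  pose x1 := base_point P idfun (curve_a D 1 1) (curve_b D 1 1).
  pose l1 y := mmap idfun (row_mx x1 y 0) g.
  pose l2 y := mmap idfun (row_mx x1 y 0) h.
  have lin1 a u v : l1 (a *: u + v) = a * l1 u + l1 v by apply: ydeg1_linear.
  have lin2 a u v : l2 (a *: u + v) = a * l2 u + l2 v by apply: ydeg1_linear.
  have prod u : qf (fibre D 1 1) u = l1 u * l2 u by rewrite -fibre_eval efgh rmorphM.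
  have on : qf (fibre D 1 1) (curve_point D 1 1) = 0.
    by have := fibre_on N0b0 moves idfun 1 1; rewrite map_datum_id.
  have nres : resultant_at (fibre D 1 1) (curve_point D 1 1) (b2 D) (b0 D) != 0.
    by apply: contraNneq good_b2 => z; rewrite /good_line z mulr0 mul0r.
  case/negP: nres; apply/eqP; move/eqP: on; rewrite prod mulf_eq0 => /orP[] /eqP z.
    exact: (product_of_linear_forms (l1 := l1) (l2 := l2)).
  apply: (product_of_linear_forms (l1 := l2) (l2 := l1)) => // u.
  by rewrite prod mulrC.
- have j0 : j = 0%N by case: eij; case: (i) => //= i'; lia.
  rewrite j0 in hj; right; apply: (@ydeg0_factor_unit h g) => //.
  by rewrite mulrC.
Qed.

End Irreducible.

(** * The rational map dominates the divisor *)

Section Parametrization.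
Variables (k : fieldType) (n : nat) (P : 'M[k]_2) (D : datum k n.+1).
Hypothesis k_infinite : infinite_field k.
Hypothesis P_unit : P \in unitmx.
Hypothesis N0b0 : qf (N0 D) (b0 D) = 0.
Hypothesis dual00 : linv (e0 D) (b0 D) = 1.
Hypothesis dual02 : linv (e0 D) (b2 D) = 0.
Hypothesis dual20 : linv (e2 D) (b0 D) = 0.
Hypothesis dual22 : linv (e2 D) (b2 D) = 1.
Hypothesis goodD : good_datum D != 0.
Variables (f : {mpoly k[2 + n.+1]}).
Hypothesis bihom_f : bihomogeneous 3 2 f.
Hypothesis f_pencil : pencil_equation P D f.

Let moves : moving_base D != 0.
Proof. by apply: contraNneq goodD => z; rewrite /good_datum z mulr0 !mul0r. Qed.

Let good_b2 : good_line D 1 (b2 D) != 0.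
Proof. by apply: contraNneq goodD => z; rewrite /good_datum z mulr0 !mul0r. Qed.

Let indep : \det (value_matrix D) != 0.
Proof. by apply: contraNneq goodD => z; rewrite /good_datum z !mul0r. Qed.

Local Notation S := {mpoly k[n.+1]}.
Let cst : {rmorphism k -> S} := @mpolyC _ k.

Definition vars : 'rV[S]_n.+1 := \row_i 'X_i.

Definition param_x_at (A : comNzRingType) (iota : {rmorphism k -> A}) (t : 'rV[A]_n.+1) :=
  let DA := map_datum iota D in
  base_point P iota (curve_a DA (linv (e0 DA) t) (linv (e2 DA) t))
              (curve_b DA (linv (e0 DA) t) (linv (e2 DA) t)).

Lemma map_param_x (A B : comNzRingType) (iota : {rmorphism k -> A})
    (s : {rmorphism A -> B}) (iota' : {rmorphism k -> B}) (t : 'rV[A]_n.+1) :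
  s \o iota =1 iota' ->
  map_mx s (param_x_at iota t) = param_x_at iota' (map_mx s t).
Proof.
move=> e; rewrite /param_x_at map_base_point -map_curve_a -map_curve_b -!map_linv (eq_base_point _ _ _ e).
by rewrite map_datum_comp (eq_map_datum _ e) /= -!map_mx_comp !(eq_map_mx _ e).
Qed.

Lemma map_param_y (A B : comNzRingType) (iota : {rmorphism k -> A})
    (s : {rmorphism A -> B}) (iota' : {rmorphism k -> B}) (t : 'rV[A]_n.+1) :
  s \o iota =1 iota' ->
  map_mx s (bundle_point (map_datum iota D) t) = bundle_point (map_datum iota' D) (map_mx s t).
Proof. by move=> e; rewrite -map_bundle_point map_datum_comp (eq_map_datum _ e). Qed.

Definition param_x : 'rV[S]_2 := param_x_at cst vars.
Definition param_y : 'rV[S]_n.+1 := bundle_point (map_datum cst D) vars.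

Lemma map_vars (A : comNzRingType) (iota : {rmorphism k -> A}) (t : 'rV[A]_n.+1) :
  map_mx (mmap iota (t 0)) vars = t.
Proof. by apply/rowP=> i; rewrite !mxE /= mmapX mmap1U. Qed.

Lemma mmap_cst (A : comNzRingType) (iota : {rmorphism k -> A}) (t : 'rV[A]_n.+1) :
  mmap iota (t 0) \o cst =1 iota.
Proof. by move=> c; rewrite /= mmapC. Qed.

Lemma eval_param_x (A : comNzRingType) (iota : {rmorphism k -> A}) (t : 'rV[A]_n.+1) :
  map_mx (mmap iota (t 0)) param_x = param_x_at iota t.
Proof. by rewrite (map_param_x _ (mmap_cst iota t)) map_vars. Qed.

Lemma eval_param_y (A : comNzRingType) (iota : {rmorphism k -> A}) (t : 'rV[A]_n.+1) :
  map_mx (mmap iota (t 0)) param_y = bundle_point (map_datum iota D) t.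
Proof. by rewrite (map_param_y _ (mmap_cst iota t)) map_vars. Qed.

Lemma param_x_neq0 : param_x != 0.
Proof.
apply/eqP => z; have := eval_param_x idfun (b0 D + b2 D).
rewrite z map_mx0 /param_x_at map_datum_id !linvD dual00 dual02 dual20 dual22 add0r addr0.
move=> b00; case/negP: good_b2; apply/eqP; rewrite /good_line.
suff -> : qf (fibre D 1 1) (b0 D) = 0 by rewrite mulr0.
have := f_pencil idfun (curve_a D 1 1) (curve_b D 1 1) (b0 D).
rewrite map_datum_id -/(fibre D 1 1) -b00 => <-.
have := bihomogeneousZ idfun (0 : 'rV[k]_2) (b0 D) 0 1 bihom_f.
by rewrite scaler0 scale1r expr0n !mul0r.
Qed.

Lemma param_y_neq0 : param_y != 0.
Proof.
apply/eqP => z; have := eval_param_y idfun (b0 D + b2 D).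
rewrite z map_mx0 map_datum_id => b00.
case/negP: goodD; rewrite /good_datum -b00 /linv mul0mx mxE mulr0; exact: eqxx.
Qed.

Let scaling : {rmorphism S -> {poly S}} :=
  mmap (polyC \o cst) (fun i => 'X^1 * ('X_i)%:P).

Lemma scaling_cst : scaling \o cst =1 polyC \o cst.
Proof. by move=> c; rewrite /scaling /= mmapC. Qed.

Lemma scaling_vars : map_mx scaling vars = 'X *: map_mx polyC vars.
Proof. by apply/rowP=> i; rewrite !mxE /scaling /= mmapX mmap1U expr1. Qed.

(** The degrees are read off from the behaviour of the construction under scaling of [t]. *)
Lemma homog_of_scaling (p : S) d : scaling p = 'X^d * p%:P -> p \is d.-homog.
Proof.
rewrite mulrC => E; apply/dhomogP => m mp.
have <- := @wscale_homog k n.+1 (fun=> 1%N) p d E m mp.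
transitivity (\sum_(i < n.+1) m i)%N; first exact: mdegE.
by apply: eq_bigr => i _; rewrite mul1n.
Qed.

Lemma param_x_homog : exists d, forall i, param_x 0 i \is d.-homog.
Proof.
exists 8 => i; apply: homog_of_scaling.
transitivity (map_mx scaling param_x 0 i); first by rewrite [RHS]mxE.
rewrite (map_param_x _ scaling_cst) scaling_vars /param_x_at !linvZ curve_aZ curve_bZ base_pointZ.
have := map_param_x vars (fun c => erefl : (polyC \o cst) c = (polyC \o cst) c).
by rewrite /param_x_at => <-; rewrite [LHS]mxE [in LHS]mxE.
Qed.

Lemma param_y_homog : exists d, forall i, param_y 0 i \is d.-homog.
Proof.
exists 30 => i; apply: homog_of_scaling.
transitivity (map_mx scaling param_y 0 i); first by rewrite [RHS]mxE.
rewrite (map_param_y _ scaling_cst) scaling_vars bundle_pointZ.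
rewrite -(map_param_y vars (fun c => erefl : (polyC \o cst) c = (polyC \o cst) c)).
by rewrite [LHS]mxE [in LHS]mxE.
Qed.

Definition param : rational_map k n n :=
  RationalMap param_x_neq0 param_y_neq0 param_x_homog param_y_homog.

Lemma param_image : image_in param f.
Proof.
move=> K iota t _ _ _; rewrite /vanishes_at /eval_row /= eval_param_x eval_param_y.
by rewrite f_pencil; apply: qf_residual; apply: fibre_on.
Qed.

(** Evaluation at the generic point of [P^n], with values in the field of rational functions. *)
Lemma image_in_identity (g : {mpoly k[2 + n.+1]}) : image_in param g ->
  mmap cst (row_mx param_x param_y 0) g = 0.
Proof.
move=> img.
pose tau : {rmorphism S -> {fraction S}} := @FracField.tofrac S.
have tau_inj : injective tau by move=> x y /eqP; rewrite tofrac_eq => /eqP.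
pose iota : {rmorphism k -> {fraction S}} := tau \o cst.
pose t := map_mx tau vars.
have ev p : mmap iota (t 0) p = tau p.
  rewrite -[in RHS](mmap_vars p) rmorph_mmap; apply: eq_mmap => i //=.
  by rewrite !mxE.
have ne0 m (u : 'rV[S]_m) : u != 0 -> eval_row iota u t != 0.
  apply: contraNneq => z; apply/eqP/rowP => i; apply: (tau_inj).
  have := congr1 (fun M : 'rV[{fraction S}]_m => M 0 i) z.
  by rewrite /eval_row !mxE ev rmorph0.
have t0 : t != 0.
  apply/eqP => /(congr1 (fun M : 'rV[{fraction S}]_n.+1 => M 0 0)).
  rewrite !mxE -(rmorph0 tau) => /tau_inj/(congr1 (mcoeff U_(0))).
  by rewrite mcoeffX eqxx mcoeff0 => /eqP; rewrite oner_eq0.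
have := img _ iota t t0 (ne0 _ _ param_x_neq0) (ne0 _ _ param_y_neq0).
rewrite /vanishes_at /eval_row /= => z; apply: (tau_inj); rewrite rmorph0 -z rmorph_mmap.
apply: eq_mmap => // i; rewrite /= -map_row_mx [RHS]mxE.
exact: esym (ev _).
Qed.

Lemma param_dominant : dominant_onto param f.
Proof.
split; first exact: param_image.
move=> dx dy g bihom_g /image_in_identity g0.
apply: (zeros_subset_of_image k_infinite P_unit N0b0 moves good_b2 indep f_pencil bihom_g).
move=> A iota t DA t0 t2.
rewrite -/(param_x_at iota t) -eval_param_x -eval_param_y.
have := congr1 (mmap iota (t 0)) g0; rewrite rmorph_mmap rmorph0 => <-.
apply: eq_mmap => [c|i]; first by rewrite /= mmapC.
by rewrite -map_row_mx [LHS]mxE.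
Qed.

Theorem unirational_of_good : unirational_divisor f.
Proof.
split; first exact: (irreducible_of_good P_unit N0b0 moves good_b2 indep bihom_f f_pencil).
by exists param; apply: param_dominant.
Qed.

End Parametrization.

(** * An explicit nondegenerate equation *)

Section Example.
Variables (k : fieldType) (m : nat) (D : datum k m) (c1 c3 c4 : 'cV[k]_m).
Local Notation y0 := (linv (e0 D)).
Local Notation y1 := (linv c1).
Local Notation y2 := (linv (e2 D)).
Local Notation y3 := (linv c3).
Local Notation y4 := (linv c4).
Hypothesis hb0 : [/\ y0 (b0 D) = 1, y1 (b0 D) = 0, y2 (b0 D) = 0,
  y3 (b0 D) = 0 & y4 (b0 D) = 0].
Hypothesis hb1 : [/\ y0 (b1 D) = 0, y1 (b1 D) = 1, y2 (b1 D) = 0,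
  y3 (b1 D) = 0 & y4 (b1 D) = 0].
Hypothesis hb2 : [/\ y0 (b2 D) = 0, y1 (b2 D) = 0, y2 (b2 D) = 1,
  y3 (b2 D) = 0 & y4 (b2 D) = 0].
Hypothesis hb3 : [/\ y0 (b3 D) = 0, y1 (b3 D) = 0, y2 (b3 D) = 0,
  y3 (b3 D) = 1 & y4 (b3 D) = 0].
Hypothesis hb4 : [/\ y0 (b4 D) = 0, y1 (b4 D) = 0, y2 (b4 D) = 0,
  y3 (b4 D) = 0 & y4 (b4 D) = 1].
Hypothesis hN0 : forall y, qf (N0 D) y = y0 y * y1 y.
Hypothesis hN1 : forall y, qf (N1 D) y = y0 y ^+ 2.
Hypothesis hN2 : forall y, qf (N2 D) y = y0 y * y1 y + y3 y ^+ 2.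
Hypothesis hN3 : forall y, qf (N3 D) y = y0 y * y2 y + y3 y * y4 y + y1 y ^+ 2.

Lemma bf_qf (M : 'M[k]_m) y z : bf M y z = qf M (y + z) - qf M y - qf M z.
Proof. by rewrite qfD; ring. Qed.

Let coordE := (linvD, linvZ).

Let al : [/\ qf (N1 D) (b0 D) = 1, qf (N2 D) (b0 D) = 0 & qf (N3 D) (b0 D) = 0].
Proof. by case: hb0 => a b c d e; rewrite hN1 hN2 hN3 a b c d e; split; ring. Qed.

Let qrem1 y : qf (remainder1 D) y = y0 y * y1 y + y3 y ^+ 2.
Proof. by case: al => a b c; rewrite /remainder1 !qfDM !qfZM a b c hN0 hN1 hN2; ring. Qed.

Let qrem2 y : qf (remainder2 D) y = y0 y * y2 y + y3 y * y4 y + y1 y ^+ 2.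
Proof. by case: al => a b c; rewrite /remainder2 !qfDM !qfZM a b c hN0 hN1 hN3; ring. Qed.

Let brem1 y z : bf (remainder1 D) y z = y0 y * y1 z + y0 z * y1 y + 2%:R * y3 y * y3 z.
Proof. by rewrite bf_qf !qrem1 !linvD; ring. Qed.

Let brem2 y z : bf (remainder2 D) y z =
  y0 y * y2 z + y0 z * y2 y + y3 y * y4 z + y3 z * y4 y + 2%:R * y1 y * y1 z.
Proof. by rewrite bf_qf !qrem2 !linvD; ring. Qed.

Let l1 y : bf (remainder1 D) (b0 D) y = y1 y.
Proof. by case: hb0 => a b c d e; rewrite brem1 a b d; ring. Qed.

Let l2 y : bf (remainder2 D) (b0 D) y = y2 y.
Proof. by case: hb0 => a b c d e; rewrite brem2 a b c d e; ring. Qed.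

Let tdet1 : tangent_det D = 1.
Proof.
case: hb1 => _ a1 a2 _ _; case: hb2 => _ a3 a4 _ _.
by rewrite tangent_det_def !l1 !l2 a1 a2 a3 a4; ring.
Qed.

Let tproj_id y : y1 y = 0 -> y2 y = 0 -> tangent_proj D y = y.
Proof.
move=> z1 z2; rewrite tangent_proj_def !l1 !l2 z1 z2 tdet1.
by rewrite !(mul0r, mulr0, subr0) !scale0r scale1r !addr0.
Qed.

Let proj3 : tangent_proj D (b3 D) = b3 D.
Proof. by case: hb3 => _ a b _ _; apply: tproj_id. Qed.

Let proj4 : tangent_proj D (b4 D) = b4 D.
Proof. by case: hb4 => _ a b _ _; apply: tproj_id. Qed.

Let node_vectorE t0 t2 : node_vector D t0 t2 = t2 *: b4 D + t0 *: b1 D.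
Proof.
rewrite node_vector_def proj3 proj4 !l1 !l2 !qrem1 !qrem2.
case: hb1 => _ -> -> _ _; case: hb2 => _ -> -> _ _; case: hb3 => -> -> -> -> ->.
congr (_ + _ *: _).
set u := (X in X *: b1 D + _); set v := (X in _ + X *: b2 D).
have -> : u = 1 by rewrite /u; ring.
have -> : v = 0 by rewrite /v; ring.
by rewrite scale1r scale0r addr0.
Qed.

Let curve t0 t2 : [/\ y0 (curve_point D t0 t2) = - t0 ^+ 4,
  y1 (curve_point D t0 t2) = t0 ^+ 2 * t2 ^+ 2,
  y2 (curve_point D t0 t2) = 0, y3 (curve_point D t0 t2) = - (t0 ^+ 3 * t2) &
  y4 (curve_point D t0 t2) = t0 * t2 ^+ 3].
Proof.
rewrite curve_point_def proj3 node_vectorE tdet1 /quartic_point !qrem1 !qrem2 !brem1 !brem2 !coordE.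
case: hb0 => -> -> -> -> ->; case: hb1 => -> -> -> -> ->.
by case: hb3 => -> -> -> -> ->; case: hb4 => -> -> -> -> ->; split; ring.
Qed.

Let xa t0 t2 : curve_a D t0 t2 = - t0 ^+ 8.
Proof. by case: al (curve t0 t2) => a b _ [z _ _ _ _]; rewrite curve_a_def a b hN0 hN1 z; ring. Qed.

Let xb t0 t2 : curve_b D t0 t2 = - (t0 ^+ 6 * t2 ^+ 2).
Proof. by case: al (curve t0 t2) => a b _ [z z' _ _ _]; rewrite curve_b_def a hN0 z z'; ring. Qed.

Let qfibre y : qf (fibre D 1 1) y =
  - (2%:R * (y0 y * y1 y) + y0 y ^+ 2 + y3 y ^+ 2 + y0 y * y2 y + y3 y * y4 y + y1 y ^+ 2).
Proof. by rewrite /fibre xa xb cubic_pencil_qf hN0 hN1 hN2 hN3; ring. Qed.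

Let bfibre y z : bf (fibre D 1 1) y z =
  - (2%:R * (y0 y * y1 z + y0 z * y1 y) + 2%:R * y0 y * y0 z + 2%:R * y3 y * y3 z
     + (y0 y * y2 z + y0 z * y2 y) + (y3 y * y4 z + y3 z * y4 y) + 2%:R * y1 y * y1 z).
Proof. by rewrite bf_qf !qfibre !linvD; ring. Qed.

Let det_gram : \det (value_matrix D) != 0.
Proof.
pose X : 'M[k]_4 := \matrix_(i, j) nth 0 (nth [::] [:: [:: -1; 1; 0; 0]; [:: -1; 0; 1; 0];
   [:: -1; 0; 0; 1]; [:: 1; 0; 0; 0]] i) j.
suff XG : X *m value_matrix D = 1%:M.
  have := congr1 determinant XG; rewrite det_mulmx det1 => /eqP; apply: contraTneq => ->.
  by rewrite mulr0 eq_sym oner_eq0.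
have hv := (hN0, hN1, hN2, hN3, linvD).
case: hb0 => z00 z01 z02 z03 z04; case: hb1 => z10 z11 z12 z13 z14.
case: hb3 => z30 z31 z32 z33 z34.
have hz := (z00, z01, z02, z03, z04, z10, z11, z12, z13, z14, z30, z31, z32, z33, z34).
apply/matrixP => i j; rewrite !mxE !big_ord_recl big_ord0 !mxE.
case: i => -[|[|[|[|i]]]] hi //; case: j => -[|[|[|[|j]]]] hj //=.
all: by rewrite !hv !hz; ring.
Qed.

(** For these forms [u = a^2], the remainder quadrics are [N2] and [N3], the curve is [(- t0^4,
t0^2 t2^2, 0, - t0^3 t2, t0 t2^3)], and its image in [P^1] is [(- t0^8 : - t0^6 t2^2)]. All the
conditions take the value 1 or -1, whatever the characteristic. *)
Lemma good_datum_example : good_datum D != 0.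
Proof.
have [z0 z1 z2 z3 z4] := curve 1 1.
have [w00 w01 w02 w03 w04] := hb0; have [w20 w21 w22 w23 w24] := hb2.
have hw := (w00, w01, w02, w03, w04, w20, w21, w22, w23, w24, z0, z1, z2, z3, z4).
have eN : linv (e0 D) (bundle_point D (b0 D + b2 D)) = -1.
  rewrite /bundle_point !linvD !hw addr0 add0r /residual !coordE qfibre bfibre !linvD !hw; ring.
have em : moving_base D = 1 by rewrite /moving_base !xa !xb; ring.
have eg : good_line D 1 (b2 D) = 1.
  rewrite /good_line /gap /cross /resultant_at !bfibre !qfibre !coordE !hw; ring.
by rewrite /good_datum eN em eg !mulr1 mulrN1 oppr_eq0.
Qed.

End Example.

(** * Openness and the conclusion *)

(** A nonzero row has rank 1, so in its rank decomposition it is a multiple of the first row of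
an invertible matrix. *)
Lemma unit_extension (k : fieldType) m (v : 'rV[k]_m.+1) : v != 0 ->
  exists2 Q : 'M[k]_m.+1, Q \in unitmx & row 0 Q = v.
Proof.
move=> v0; have rv : \rank v = 1%N by apply/eqP; rewrite eqn_leq rank_leq_row lt0n mxrank_eq0.
have /matrixP ev := mulmx_ebase v.
pose c := col_ebase v 0 0.
have c0 : c != 0.
  have := col_ebase_unit v; rewrite unitmxE unitfE; apply: contraNneq => z.
  by rewrite [col_ebase v]mx11_scalar -/c z raddf0 det0.
exists (c *: row_ebase v); first by rewrite unitmxZ ?unitfE // row_ebase_unit.
apply/rowP=> i; rewrite -[RHS]ev rv !mxE big_ord_recl big1 ?addr0 => [|l _]; last first.
  by rewrite !mxE big1 ?mul0r // => z _; rewrite !mxE ord1 /= mulr0.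
by rewrite !mxE big_ord_recl big_ord0 addr0 !mxE /= mulr1.
Qed.

Section Bihomogeneous.
Variables (k : fieldType) (n : nat).
Implicit Types f g : {mpoly k[2 + n.+1]}.

Lemma bihomogeneousD d e f g :
  bihomogeneous d e f -> bihomogeneous d e g -> bihomogeneous d e (f + g).
Proof.
move=> hf hg m /msuppD_le; rewrite mem_cat => /orP[]; [exact: hf | exact: hg].
Qed.

Lemma bihomogeneousM d e d' e' f g :
  bihomogeneous d e f -> bihomogeneous d' e' g -> bihomogeneous (d + d') (e + e') (f * g).
Proof.
move=> hf hg m /msuppM_le/allpairsP[[u v] /= [/hf[<- <-] /hg[<- <-] ->]].
by rewrite -!big_split; split; apply: eq_bigr => i _; rewrite mnmDE.
Qed.

Lemma bihomogeneousC c : bihomogeneous 0 0 (c%:MP : {mpoly k[2 + n.+1]}).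
Proof.
move=> m /= mc; have -> : m = 0%MM.
  by move: mc; rewrite msuppC; case: eqP => // _; rewrite inE => /eqP.
by split; rewrite big1 // => i _; rewrite mnm0E.
Qed.

Lemma bihomogeneousX d e f l : bihomogeneous d e f -> bihomogeneous (l * d) (l * e) (f ^+ l).
Proof.
move=> hf; elim: l => [|l IH]; last by rewrite exprS !mulSn; apply: bihomogeneousM.
by rewrite expr0 !mul0n -mpolyC1; apply: bihomogeneousC.
Qed.

Lemma bihomogeneous_sum d e (I : finType) (F : I -> {mpoly k[2 + n.+1]}) :
  (forall i, bihomogeneous d e (F i)) -> bihomogeneous d e (\sum_i F i).
Proof.
move=> h; elim/big_ind: _ => //; last by move=> *; apply: bihomogeneousD.
by move=> m; rewrite msupp0.
Qed.

Lemma bihomogeneous_x i : bihomogeneous 1 0 ('X_(lshift n.+1 i) : {mpoly k[2 + n.+1]}).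
Proof.
move=> m; rewrite msuppX inE => /eqP ->; split.
  rewrite (bigD1 i) //= mnm1E eqxx big1 // => l li.
  by rewrite mnm1E (inj_eq (@lshift_inj _ _)) eq_sym (negbTE li).
by rewrite big1 // => l _; rewrite mnm1E eq_lrshift.
Qed.

Lemma bihomogeneous_y i : bihomogeneous 0 1 ('X_(rshift 2 i) : {mpoly k[2 + n.+1]}).
Proof.
move=> m; rewrite msuppX inE => /eqP ->; split; last first.
  rewrite (bigD1 i) //= mnm1E eqxx big1 // => l li.
  by rewrite mnm1E (inj_eq (@rshift_inj _ _)) eq_sym (negbTE li).
by rewrite big1 // => l _; rewrite mnm1E eq_rlshift.
Qed.

End Bihomogeneous.

Section Openness.
Variables (k : fieldType) (n : nat) (P : 'M[k]_2).
Variables (b : 'M[k]_(5, n.+1)) (e : 'M[k]_(n.+1, 5)).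
Local Notation bmon := 'X_{1..(2 + n.+1) < 6}.
Local Notation r := #|{: bmon}|.

Definition all_monomials : r.-tuple 'X_{1..2 + n.+1} :=
  [tuple (enum_val i : bmon) : 'X_{1..2 + n.+1} | i < r].

Definition generic_matrix l : 'M[{mpoly k[r]}]_n.+1 :=
  \sum_(m : bmon) 'X_(enum_rank m) *: map_mx (@mpolyC _ k) (monomial_matrix P l m).

Definition generic_datum : datum {mpoly k[r]} n.+1 :=
  Datum (generic_matrix 0) (generic_matrix 1) (generic_matrix 2) (generic_matrix 3)
    (map_mx (@mpolyC _ k) (row 0 b)) (map_mx (@mpolyC _ k) (row 1 b))
    (map_mx (@mpolyC _ k) (row 2%:R b)) (map_mx (@mpolyC _ k) (row 3%:R b))
    (map_mx (@mpolyC _ k) (row 4%:R b))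
    (map_mx (@mpolyC _ k) (col 0 e)) (map_mx (@mpolyC _ k) (col 2%:R e)).

(** The condition for the equation with indeterminate coefficients specializes to the condition
for [f]. *)
Lemma good_datum_is_polynomial (f : {mpoly k[2 + n.+1]}) :
  coef_eval all_monomials (good_datum generic_datum) f = good_datum (datum_of P b e f).
Proof.
rewrite /coef_eval; set h := fun i => _.
have hE m : h (enum_rank m) = f@_m by rewrite /h tnth_mktuple enum_rankK.
pose ev : {rmorphism {mpoly k[r]} -> k} := mmap idfun h.
rewrite -[LHS]/(ev _) -map_good_datum; congr good_datum.
have evC p q (M : 'M[k]_(p, q)) : map_mx ev (map_mx (@mpolyC _ k) M) = M.
  by apply/matrixP => i j; rewrite !mxE /= mmapC.
have evM l : map_mx ev (generic_matrix l) = coef_matrix P l f.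
  rewrite map_mx_sum; apply: eq_bigr => m _; rewrite map_mxZ evC.
  by rewrite /= mmapX mmap1U hE.
by rewrite /map_datum /= !evM !evC.
Qed.

End Openness.

Lemma linv_dual (k : fieldType) l m (b : 'M[k]_(l, m)) (e : 'M[k]_(m, l)) :
  b *m e = 1%:M -> forall i j, linv (col i e) (row j b) = (j == i)%:R.
Proof.
move=> dual i j; transitivity ((b *m e) j i); last by rewrite dual mxE.
by rewrite /linv !mxE; apply: eq_bigr => z _; rewrite !mxE.
Qed.

Section ExampleEquation.
Variables (k : fieldType) (n : nat) (P : 'M[k]_2) (P_unit : P \in unitmx).
Variables (b : 'M[k]_(5, n.+1)) (e : 'M[k]_(n.+1, 5)).
Hypothesis dual : b *m e = 1%:M.

Definition example_form (A : comNzRingType) (a c : A) (y : 'I_5 -> A) : A :=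
  a ^+ 3 * (y 0 * y 1) + a ^+ 2 * c * y 0 ^+ 2
  + a * c ^+ 2 * (y 0 * y 1 + y 3%:R ^+ 2)
  + c ^+ 3 * (y 0 * y 2%:R + y 3%:R * y 4%:R + y 1 ^+ 2).

Lemma map_example_form (A B : comNzRingType) (s : {rmorphism A -> B}) a c y :
  s (example_form a c y) = example_form (s a) (s c) (s \o y).
Proof. by rewrite /example_form !(rmorphD, rmorphM, rmorphXn). Qed.

Local Notation R := {mpoly k[2 + n.+1]}.
Let j : {rmorphism k -> R} := @mpolyC _ k.

Definition ecoord (A : comNzRingType) (iota : k -> A) (y : 'rV[A]_n.+1) (i : 'I_5) : A :=
  linv (map_mx iota (col i e)) y.

Definition example : R :=
  example_form (coords P j (generic_x k n) 0 0) (coords P j (generic_x k n) 0 1)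
    (ecoord j (generic_y k n)).

Lemma bihomogeneous_example : bihomogeneous 3 2 example.
Proof.
have ha i : bihomogeneous 1 0 (coords P j (generic_x k n) 0 i).
  rewrite /coords mxE; apply: bihomogeneous_sum => l; rewrite !mxE.
  by apply: (@bihomogeneousM _ _ 1 0 0 0); [apply: bihomogeneous_x | apply: bihomogeneousC].
have hy i : bihomogeneous 0 1 (ecoord j (generic_y k n) i).
  rewrite /ecoord /linv mxE; apply: bihomogeneous_sum => l; rewrite !mxE.
  by apply: (@bihomogeneousM _ _ 0 1 0 0); [apply: bihomogeneous_y | apply: bihomogeneousC].
rewrite /example /example_form; move: (ha 0) (ha 1) hy.
move: (coords _ _ _ 0 0) (coords _ _ _ 0 1) (ecoord _ _) => a c y {}ha hc hy.
have hyy i l : bihomogeneous 0 2 (y i * y l) by apply: (@bihomogeneousM _ _ 0 1 0 1).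
have hy2 i : bihomogeneous 0 2 (y i ^+ 2) by apply: (@bihomogeneousX _ _ 0 1 _ 2).
have ha3 : bihomogeneous 3 0 (a ^+ 3) by apply: (@bihomogeneousX _ _ 1 0 _ 3).
have hc3 : bihomogeneous 3 0 (c ^+ 3) by apply: (@bihomogeneousX _ _ 1 0 _ 3).
have haac : bihomogeneous 3 0 (a ^+ 2 * c).
  by apply: (@bihomogeneousM _ _ 2 0 1 0) => //; apply: (@bihomogeneousX _ _ 1 0 _ 2).
have hacc : bihomogeneous 3 0 (a * c ^+ 2).
  by apply: (@bihomogeneousM _ _ 1 0 2 0) => //; apply: (@bihomogeneousX _ _ 1 0 _ 2).
repeat apply: bihomogeneousD; apply: (@bihomogeneousM _ _ 3 0 0 2) => //.
- exact: bihomogeneousD.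
- by apply: bihomogeneousD => //; apply: bihomogeneousD.
Qed.

Lemma eval_example (A : comNzRingType) (iota : {rmorphism k -> A}) (a c : A)
    (y : 'rV[A]_n.+1) :
  mmap iota (row_mx (base_point P iota a c) y 0) example =
  example_form a c (ecoord iota y).
Proof.
have [ev [evj ex ey]] := gen_specialize iota (base_point P iota a c) y.
have -> : mmap iota (row_mx (base_point P iota a c) y 0) example = ev example.
  rewrite -[in RHS](mmap_gen example) rmorph_mmap; apply: eq_mmap => [z|i] /=.
    by rewrite -evj.
  by rewrite -ex -ey -map_row_mx [LHS]mxE.
have ec i : ev (ecoord j (generic_y k n) i) = ecoord iota y i.
  by rewrite /ecoord -map_linv -map_mx_comp (eq_map_mx _ evj) ey.
have ecx i : ev (coords P j (generic_x k n) 0 i) = coords P iota (base_point P iota a c) 0 i.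
  have := map_coords P (generic_x k n) evj; rewrite ex => <-.
  by rewrite [RHS]mxE.
rewrite /example map_example_form !ecx coords_base_point //.
rewrite [(\row__ _) 0 0]mxE [(\row__ _) 0 1]mxE.
by rewrite /example_form /= !ec.
Qed.

Lemma example_matrix_forms (y : 'rV[k]_n.+1) :
  let D := datum_of P b e example in let z := ecoord idfun y in
  [/\ qf (N0 D) y = z 0 * z 1, qf (N1 D) y = z 0 ^+ 2,
      qf (N2 D) y = z 0 * z 1 + z 3%:R ^+ 2 &
      qf (N3 D) y = z 0 * z 2%:R + z 3%:R * z 4%:R + z 1 ^+ 2].
Proof.
move=> D z.
have E := eval_example (@polyC k) 1 'X (map_mx polyC y).
have ez i : ecoord (@polyC k) (map_mx polyC y) i = (z i)%:P.
  by rewrite /ecoord map_linv /z /ecoord map_mx_id.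
rewrite (mmap_cubic_pencil P b e _ _ _ _ bihomogeneous_example) cubic_pencil_qf in E.
rewrite /= !map_qf /example_form !ez in E.
have {}E : \poly_(i < 4) nth 0 [:: qf (N0 D) y; qf (N1 D) y; qf (N2 D) y; qf (N3 D) y] i =
   \poly_(i < 4) nth 0 [:: z 0 * z 1; z 0 ^+ 2; z 0 * z 1 + z 3%:R ^+ 2;
     z 0 * z 2%:R + z 3%:R * z 4%:R + z 1 ^+ 2] i :> {poly k}.
  rewrite !poly_def !big_ord_recr !big_ord0 /= -!mul_polyC.
  rewrite !(polyCD, polyCM, polyC_exp).
  transitivity (1 ^+ 3 * (qf (N0 D) y)%:P + 1 ^+ 2 * 'X * (qf (N1 D) y)%:P
     + 1 * 'X ^+ 2 * (qf (N2 D) y)%:P + 'X ^+ 3 * (qf (N3 D) y)%:P); first ring.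
  rewrite E; ring.
have ek l := congr1 (fun q : {poly k} => q`_l) E.
split; [have := ek 0%N | have := ek 1%N | have := ek 2%N | have := ek 3%N];
  by rewrite !coef_poly.
Qed.

Lemma example_is_good : good_datum (datum_of P b e example) != 0.
Proof.
have dualE := linv_dual dual.
have zE (y : 'rV[k]_n.+1) i : ecoord idfun y i = linv (col i e) y.
  by rewrite /ecoord map_mx_id.
apply: (@good_datum_example _ _ _ (col 1 e) (col 3%:R e) (col 4%:R e)) => [| | | | |y|y|y|y] /=.
1-5: by split; rewrite dualE.
all: by case: (example_matrix_forms y) => [h0 h1 h2 h3]; rewrite -!zE.
Qed.

Lemma example_through : vanishes_at idfun example (row 0 P) (row 0 b).
Proof.
have -> : row 0 P = base_point P idfun 1 0.
  by rewrite /base_point map_mx_id // scale1r scale0r addr0.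
rewrite /vanishes_at eval_example /example_form.
have -> : ecoord idfun (row 0 b) 1 = 0; last by ring.
by rewrite /ecoord map_mx_id // (linv_dual dual).
Qed.

End ExampleEquation.

Theorem proposition3p2 (k : fieldType) (n : nat)
    (p : 'rV[k]_2) (q : 'rV[k]_n.+1) :
  infinite_field k -> 2%N \notin [pchar k] -> (4 <= n)%N ->
  p != 0 -> q != 0 ->
  for_general (forms_through 3 2 p q) (@unirational_divisor k n).
Proof.
move=> k_infinite _ n4 p0 q0.
have [P P_unit rP] := unit_extension p0.
have [Q Q_unit rQ] := unit_extension q0.
pose emb (i : 'I_5) : 'I_n.+1 := widen_ord (n4 : 5 <= n.+1)%N i.
pose b := rowsub emb Q; pose e := colsub emb (invmx Q).
have dual : b *m e = 1%:M.
  apply/matrixP => i l; rewrite !mxE.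
  transitivity ((Q *m invmx Q) (emb i) (emb l)).
    by rewrite mxE; apply: eq_bigr => z _; rewrite !mxE.
  by rewrite mulmxV // mxE -val_eqE.
have rb : row 0 b = q.
  by rewrite -rQ; apply/rowP => i; rewrite !mxE; congr (Q _ i); apply: val_inj.
have dualE := linv_dual dual.
exists (fun f => forms_through 3 2 p q f /\ good_datum (datum_of P b e f) != 0); split.
- exists (fun r ms F => forall f, coef_eval ms F f = good_datum (datum_of P b e f)) => f.
  split=> [[Vf gf]|[Vf [r [ms [F [SF gf]]]]]]; split=> //; last by rewrite -SF.
  exists _, (all_monomials n), (good_datum (generic_datum P b e)).
  by split=> [f'|]; rewrite good_datum_is_polynomial.
- exists (example P e); split; last exact: example_is_good.
  split; first exact: bihomogeneous_example.
  by rewrite -rP -rb; apply: example_through.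
move=> f [[bihom_f fpq] good_f].
have pencil (A : comNzRingType) (iota : {rmorphism k -> A}) a c y :=
  @mmap_cubic_pencil k n P b e A iota a c y f bihom_f.
apply: (unirational_of_good k_infinite P_unit _ _ _ _ _ good_f bihom_f pencil); rewrite /= ?dualE //.
have := pencil k idfun 1 0 q; rewrite map_datum_id cubic_pencil_qf.
have -> : base_point P idfun 1 0 = p by rewrite /base_point !map_mx_id // rP scale1r scale0r addr0.
rewrite fpq rb /= => /esym; rewrite !expr1n !mul1r !expr0n /= !(mulr0, mul0r, addr0).
exact.
Qed.
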